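(* Let $\mathcal{C}$ be a modular category of rank $5$ with $\dim(X)>0$ for every simple object $X$, and suppose that $\mathcal{C}$ is integral, i.e. $\dim(X)\in\mathbb{Z}$ for every simple object $X$. Then $\mathcal{C}$ is pointed, i.e. every simple object is invertible; that is, the Grothendieck ring $Gr(\mathcal{C})$ is isomorphic, as a based ring, to $Gr(SU(5)_1)$, the group ring of the cyclic group $\mathbb{Z}_5$ with the group elements as distinguished basis.
   Context: A modular category is a finite semisimple $\mathbb{C}$-linear rigid braided balanced (ribbon) monoidal category with simple unit object $\mathbf{1}$ whose $S$-matrix is invertible. Its rank is the number of isomorphism classes of simple objects, with representatives $\mathbf{1}=X_0,X_1,\ldots,X_{n-1}$. $\dim(X)$ denotes the categorical (quantum) dimension with respect to the ribbon structure. The $S$-matrix is $\tilde S=(\tilde s_{ij})$, where $\theta_i\theta_j\tilde s_{ij}=\sum_k N_{i^*,j}^k\dim(X_k)\theta_k$, $\theta_i$ is the twist of $X_i$, $X_{i^*}=X_i^*$ is the dual of $X_i$, and $N_{i,j}^k=\dim\mathrm{Hom}(X_i\otimes X_j,X_k)$. The Grothendieck ring $Gr(\mathcal{C})$ is the based ring with basis the isomorphism classes of simple objects and product $X_iX_j=\sum_k N_{i,j}^kX_k$; an isomorphism of based rings is a ring isomorphism carrying distinguished basis to distinguished basis. $SU(5)_1$ denotes the rank $5$ modular category whose fusion rules are addition in $\mathbb{Z}_5$. The condition that $\dim(X)>0$ for every simple object $X$ is called pseudo-unitarity. *)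

(* Defs.v *)
From mathcomp Require Import all_boot all_order all_algebra.
From mathcomp Require Import reals complex.

Set Implicit Arguments.
Unset Strict Implicit.
Unset Printing Implicit Defensive.

Import Order.TTheory GRing.Theory Num.Theory.
Local Open Scope ring_scope.

Declare Scope cat_scope.
Delimit Scope cat_scope with cat.

(* K-linear categories with finite-dimensional Hom spaces. *)
Record linearCat (K : fieldType) := LinearCat {
  obj :> Type;
  hom : obj -> obj -> vectType K;
  idm : forall X, hom X X;
  comp : forall X Y Z, hom Y Z -> hom X Y -> hom X Z;
  comp1m : forall X Y (f : hom X Y), comp (idm Y) f = f;
  compm1 : forall X Y (f : hom X Y), comp f (idm X) = f;
  compA : forall W X Y Z (h : hom Y Z) (g : hom X Y) (f : hom W X),
    comp h (comp g f) = comp (comp h g) f;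
  comp_linl : forall X Y Z (f : hom X Y), linear (fun g : hom Y Z => comp g f);
  comp_linr : forall X Y Z (g : hom Y Z), linear (fun f : hom X Y => comp g f)
}.
Arguments hom {K l} X Y.
Arguments idm {K l} X.
Arguments comp {K l X Y Z} g f.

Notation "g \o f" := (comp g f) : cat_scope.
Local Open Scope cat_scope.

Section LinearCategories.
Variables (K : fieldType) (A : linearCat K).
Implicit Types X Y Z : A.

Definition mono X Y (f : hom X Y) : Prop :=
  forall W (g h : hom W X), f \o g = f \o h -> g = h.

Definition epi X Y (f : hom X Y) : Prop :=
  forall Z (g h : hom Y Z), g \o f = h \o f -> g = h.

Definition is_iso X Y (f : hom X Y) : Prop :=
  exists g : hom Y X, g \o f = idm X /\ f \o g = idm Y.

Definition isomorphic X Y : Prop := exists f : hom X Y, is_iso f.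

Definition is_kernel X Y (f : hom X Y) W (k : hom W X) : Prop :=
  f \o k = 0 /\
  forall V (g : hom V X), f \o g = 0 -> exists! h : hom V W, k \o h = g.

Definition is_cokernel X Y (f : hom X Y) Z (q : hom Y Z) : Prop :=
  q \o f = 0 /\
  forall V (g : hom Y V), g \o f = 0 -> exists! h : hom Z V, h \o q = g.

(* For n = 0 this says that S is a zero object. *)
Definition is_direct_sum n (Y : 'I_n -> A) (S : A) : Prop :=
  exists (inj : forall k, hom (Y k) S) (proj : forall k, hom S (Y k)),
  [/\ forall k, proj k \o inj k = idm (Y k),
      forall k l, k != l -> proj k \o inj l = 0
    & \sum_k (inj k \o proj k) = idm S].

Record abelian : Prop := Abelian {
  ab_sum : forall n (Y : 'I_n -> A), exists S, is_direct_sum Y S;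
  ab_ker : forall X Y (f : hom X Y), exists W (k : hom W X), is_kernel f k;
  ab_coker : forall X Y (f : hom X Y), exists Z (q : hom Y Z), is_cokernel f q;
  ab_mono : forall X Y (f : hom X Y), mono f ->
    exists Z (g : hom Y Z), is_kernel g f;
  ab_epi : forall X Y (f : hom X Y), epi f ->
    exists W (g : hom W X), is_cokernel g f
}.

(* X is nonzero and its only subobjects are 0 and X. *)
Definition simple X : Prop :=
  idm X <> 0 /\
  forall Y (f : hom Y X), mono f -> (forall Z (g : hom Z Y), g = 0) \/ is_iso f.

Definition semisimple : Prop :=
  forall X, exists n (Y : 'I_n -> A), (forall k, simple (Y k)) /\ is_direct_sum Y X.

(* The scalar a such that f = a *: idm X, for f proportional to the identity. *)
Definition scalar_of X (f : hom X X) : K := coord [tuple idm X] ord0 f.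

End LinearCategories.

Record monoidalCat (K : fieldType) := MonoidalCat {
  mcat :> linearCat K;
  unit_ob : mcat;
  tens : mcat -> mcat -> mcat;
  tensm : forall (X X' Y Y' : mcat),
    hom X X' -> hom Y Y' -> hom (tens X Y) (tens X' Y');
  assoc : forall X Y Z : mcat, hom (tens (tens X Y) Z) (tens X (tens Y Z));
  assocV : forall X Y Z : mcat, hom (tens X (tens Y Z)) (tens (tens X Y) Z);
  lunit : forall X : mcat, hom (tens unit_ob X) X;
  runit : forall X : mcat, hom (tens X unit_ob) X;
  tensm_linl : forall (X X' Y Y' : mcat) (g : hom Y Y'),
    linear (fun f : hom X X' => tensm f g);
  tensm_linr : forall (X X' Y Y' : mcat) (f : hom X X'),
    linear (fun g : hom Y Y' => tensm f g);
  tensm_id : forall X Y : mcat, tensm (idm X) (idm Y) = idm (tens X Y);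
  tensm_comp : forall (X X' X'' Y Y' Y'' : mcat)
      (f' : hom X' X'') (f : hom X X') (g' : hom Y' Y'') (g : hom Y Y'),
    tensm (f' \o f) (g' \o g) = tensm f' g' \o tensm f g;
  assocVK : forall X Y Z : mcat, assoc X Y Z \o assocV X Y Z = idm _;
  assocK : forall X Y Z : mcat, assocV X Y Z \o assoc X Y Z = idm _;
  lunit_iso : forall X : mcat, is_iso (lunit X);
  runit_iso : forall X : mcat, is_iso (runit X);
  assoc_nat : forall (X X' Y Y' Z Z' : mcat)
      (f : hom X X') (g : hom Y Y') (h : hom Z Z'),
    assoc X' Y' Z' \o tensm (tensm f g) h = tensm f (tensm g h) \o assoc X Y Z;
  lunit_nat : forall (X X' : mcat) (f : hom X X'),
    lunit X' \o tensm (idm unit_ob) f = f \o lunit X;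
  runit_nat : forall (X X' : mcat) (f : hom X X'),
    runit X' \o tensm f (idm unit_ob) = f \o runit X;
  pentagon : forall W X Y Z : mcat,
    assoc W X (tens Y Z) \o assoc (tens W X) Y Z =
    tensm (idm W) (assoc X Y Z) \o (assoc W (tens X Y) Z
      \o tensm (assoc W X Y) (idm Z));
  triangle : forall X Y : mcat,
    tensm (idm X) (lunit Y) \o assoc X unit_ob Y = tensm (runit X) (idm Y)
}.
Arguments unit_ob {K} m.
Arguments tens {K m} X Y.
Arguments tensm {K m X X' Y Y'} f g.
Arguments assoc {K m} X Y Z.
Arguments assocV {K m} X Y Z.
Arguments lunit {K m} X.
Arguments runit {K m} X.

Notation "X \ot Y" := (tens X Y) (at level 40, left associativity) : cat_scope.
Notation "f \otm g" := (tensm f g) (at level 40, left associativity) : cat_scope.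

Section MonoidalCategories.
Variables (K : fieldType) (C : monoidalCat K).
Implicit Types X Y : C.

(* Y is a left dual of X (equivalently, X is a right dual of Y), as witnessed by
   ev and coev; the two zigzag identities are stated modulo the unitors. *)
Definition is_dual X Y (ev : hom (Y \ot X) (unit_ob C))
    (coev : hom (unit_ob C) (X \ot Y)) : Prop :=
  runit X \o (idm X \otm ev \o (assoc X Y X \o coev \otm idm X)) = lunit X /\
  lunit Y \o (ev \otm idm Y \o (assocV Y X Y \o idm Y \otm coev)) = runit Y.

Definition invertible X : Prop :=
  exists Y, isomorphic (X \ot Y) (unit_ob C) /\ isomorphic (Y \ot X) (unit_ob C).

End MonoidalCategories.

Record braidedCat (K : fieldType) := BraidedCat {
  bcat :> monoidalCat K;
  braid : forall X Y : bcat, hom (X \ot Y) (Y \ot X);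
  braid_iso : forall X Y : bcat, is_iso (braid X Y);
  braid_nat : forall (X X' Y Y' : bcat) (f : hom X X') (g : hom Y Y'),
    braid X' Y' \o f \otm g = g \otm f \o braid X Y;
  hexagon1 : forall X Y Z : bcat,
    assoc Y Z X \o (braid X (Y \ot Z) \o assoc X Y Z) =
    idm Y \otm braid X Z \o (assoc Y X Z \o braid X Y \otm idm Z);
  hexagon2 : forall X Y Z : bcat,
    assocV Z X Y \o (braid (X \ot Y) Z \o assocV X Y Z) =
    braid X Z \otm idm Y \o (assocV X Z Y \o idm X \otm braid Y Z)
}.
Arguments braid {K b} X Y.

(* Rigidity is given by chosen left duals and existing right duals.  The twist
   is compatible with duality in the form
   (theta_X (x) id) coev_X = (id (x) theta_{X*}) coev_X, i.e.
   theta_{X*} is the transpose of theta_X. *)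
Record ribbonCat (K : fieldType) := RibbonCat {
  rcat :> braidedCat K;
  dual : rcat -> rcat;
  ev : forall X : rcat, hom (dual X \ot X) (unit_ob rcat);
  coev : forall X : rcat, hom (unit_ob rcat) (X \ot dual X);
  left_dual : forall X : rcat, is_dual (ev X) (coev X);
  right_dual : forall X : rcat, exists (Y : rcat)
    (ev' : hom (X \ot Y) (unit_ob rcat)) (coev' : hom (unit_ob rcat) (Y \ot X)),
    is_dual ev' coev';
  twist : forall X : rcat, hom X X;
  twist_iso : forall X : rcat, is_iso (twist X);
  twist_nat : forall (X Y : rcat) (f : hom X Y), twist Y \o f = f \o twist X;
  twist_tens : forall X Y : rcat,
    twist (X \ot Y) = braid Y X \o (braid X Y \o twist X \otm twist Y);
  twist_dual : forall X : rcat,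
    twist X \otm idm (dual X) \o coev X = idm X \otm twist (dual X) \o coev X
}.
Arguments dual {K r} X.
Arguments ev {K r} X.
Arguments coev {K r} X.
Arguments twist {K r} X.

Section RibbonCategories.
Variables (K : fieldType) (C : ribbonCat K).

Definition qtrace (X : C) (f : hom X X) : K :=
  scalar_of (ev X \o (braid X (dual X) \o ((twist X \o f) \otm idm (dual X)
    \o coev X))).

Definition qdim (X : C) : K := qtrace (idm X).

(* The scalar by which the twist acts on a simple object. *)
Definition theta (X : C) : K := scalar_of (twist X).

(* dim Hom(X (x) Y, Z) *)
Definition fusion_coef (X Y Z : C) : nat := \dim {: hom (X \ot Y) Z}.

Definition Smatrix n (X : 'I_n -> C) : 'M[K]_n :=
  \matrix_(i, j) ((theta (X i) * theta (X j))^-1 *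
    \sum_k (fusion_coef (dual (X i)) (X j) (X k))%:R * qdim (X k) * theta (X k)).

(* C is modular of rank n+1 and the X i represent its isomorphism classes of
   simple objects.  K is meant to be the field of complex numbers. *)
Record modular n (X : 'I_n.+1 -> C) : Prop := Modular {
  mod_abelian : abelian C;
  mod_semisimple : semisimple C;
  mod_unit : simple (unit_ob C);
  mod_simple : forall i, simple (X i);
  mod_reps : forall Y : C, simple Y -> exists! i, isomorphic Y (X i);
  mod_X0 : X ord0 = unit_ob C;
  mod_S : Smatrix X \in unitmx
}.

Definition pointed : Prop := forall X : C, simple X -> invertible X.

End RibbonCategories.

(* A free Z-module of finite rank with a distinguished basis, a distinguished
   basis element bunit, and the product e_i e_j = \sum_k bcoef i j k e_k.  The
   ring axioms are not part of the structure: they are not needed to say what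
   an isomorphism is. *)
Record basedRing := BasedRing {
  bidx : finType;
  bunit : bidx;
  bcoef : bidx -> bidx -> bidx -> nat
}.

Definition bcarrier (B : basedRing) := {ffun bidx B -> int}.

Definition bbasis (B : basedRing) (i : bidx B) : bcarrier B :=
  [ffun k => (k == i)%:R].

Definition bmul (B : basedRing) (x y : bcarrier B) : bcarrier B :=
  [ffun k => \sum_i \sum_j x i * y j * (bcoef i j k)%:R].

Definition based_iso (B B' : basedRing) : Prop :=
  exists f : bcarrier B -> bcarrier B',
  [/\ bijective f,
      {morph f : x y / x + y},
      {morph f : x y / bmul x y},
      f (bbasis (bunit B)) = bbasis (bunit B')
    & (forall i, exists j, f (bbasis i) = bbasis j) /\
      (forall j, exists i, f (bbasis i) = bbasis j)].

Definition Gr (K : fieldType) (C : ribbonCat K) n (X : 'I_n.+1 -> C) : basedRing :=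
  @BasedRing 'I_n.+1 ord0 (fun i j k => fusion_coef (X i) (X j) (X k)).

(* The group ring Z[Z/5], based by the group elements. *)
Definition Gr_SU5_1 : basedRing :=
  @BasedRing 'Z_5 0 (fun a b c => nat_of_bool (a + b == c)).

(* Main.v *)
From HB Require Import structures.
From mathcomp Require Import all_boot all_order all_algebra all_field.
From mathcomp Require Import ring zify reals complex.
Require Import Defs.

Set Implicit Arguments.
Unset Strict Implicit.
Unset Printing Implicit Defensive.

Import Order.TTheory GRing.Theory Num.Theory passmx.
Local Open Scope ring_scope.
Local Open Scope cat_scope.

(** Why an integral modular category C of rank 5 is pointed.

    Let the X_i be the simple objects, N i j k the fusion coefficients, d_i the
    dimensions and th_i the twists.  Everything rests on the Hopf link pairing
      h_ij = (th_i th_j)^-1 sum_k N i j k d_k th_k,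
    which is the trace of the double braiding of X_i and X_j.  Closing only the
    strand X_i gives an endomorphism of the simple object X_j, hence a scalar
    chi_j(X_i), and h_ij = chi_j(X_i) d_j.  Because closing X (x) Y amounts to
    closing X, then Y, the map chi_j is a character of the fusion ring
    (chi_tens, chi_mult, hopf_mul).  Up to the duality of the simple objects and
    nonzero factors, h is the invertible S-matrix (hopf_unit), so the characters
    chi_j are distinct and as many as the simple objects.

    The computation with h is then classical.  Let s be the permutation of the
    simple objects given by duality (dual_perm).  Orthogonality of the
    characters to the dimension gives sum_j h_ij h_kj = D [k = s i], where
    D = sum_i d_i^2 (sum_h_h).  Hence D / d_j^2 = sum_i |chi_j(X_i)|^2
    (sum_fchar_dual, fchar_dual).  The sum is an eigenvalue of an integer matrix
    and D / d_j^2 is rational, so it is an integer (casimir_int).  It is at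
    least the number of simple objects of dimension 1, since a character has
    absolute value 1 on an invertible object (casimir_ge).

    The dimensions, normalised to d_0 = 1, are positive integers (delta_int).
    Five positive integers, one of them 1, whose squares divide the sum of the
    five squares are 1,1,1,1,1 or, up to order, 2,1,1,1,1; this follows from
    congruences modulo 8 (five_squares).  The second solution would give
    D / d_j^2 = 2 for the object of dimension 2, less than the 4 objects of
    dimension 1.  So all dimensions are 1, the product of two simple objects is
    simple (fusion_op), and the simple objects form a group of order 5
    (fusion_cyclic).

    The identities between morphisms are proved in the calculus of the
    endofunctors A (x) - of C.  A morphism between tensor products of objects
    is replaced by a family, natural in Z, of morphisms between objects such as
    A (x) (B (x) Z); a braiding becomes br, an evaluation becomes cap, a
    coevaluation becomes cup.  Composition of functors is strictly associative,
    so associators occur only in the few lemmas that relate A (x) B to the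
    composite of A (x) - and B (x) -. *)

(** * Linear categories *)

Lemma dim_le_cancel (K : fieldType) (V W : vectType K)
    (f : 'Hom(V, W)) (g : 'Hom(W, V)) :
  cancel f g -> (\dim {:V} <= \dim {:W})%N.
Proof.
move=> fgK; rewrite -(@limg_dim_eq _ _ _ f fullv) ?dimvS ?subvf //.
by rewrite (_ : lker f = 0%VS) ?capv0 //; apply/eqP/lker0P/(can_inj fgK).
Qed.

Lemma dim_eq_cancel (K : fieldType) (V W : vectType K)
    (f : 'Hom(V, W)) (g : 'Hom(W, V)) :
  cancel f g -> cancel g f -> \dim {:V} = \dim {:W}.
Proof.
by move=> fgK gfK; apply/eqP; rewrite eqn_leq (dim_le_cancel fgK) (dim_le_cancel gfK).
Qed.

(** Stated with linear maps rather than subspaces, so that it applies to a space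
    of morphisms into or out of a direct sum of objects. *)
Lemma dim_biproduct (K : fieldType) (V : vectType K) n (W : 'I_n -> vectType K)
    (inj : forall a, 'Hom(W a, V)) (prj : forall a, 'Hom(V, W a)) :
    (forall a x, prj a (inj a x) = x) ->
    (forall a b x, a != b -> prj a (inj b x) = 0) ->
    (forall v, v = \sum_a inj a (prj a v)) ->
  \dim {:V} = (\sum_a \dim {:W a})%N.
Proof.
move=> prjK prj0 sumE.
have ->: {:V}%VS = (\sum_a limg (inj a))%VS.
  apply: subv_anti; rewrite subvf andbT; apply/subvP => v _.
  by rewrite [v]sumE; apply: memv_sumr => a _; rewrite memv_img ?memvf.
have /directvP-> : directv (\sum_a limg (inj a)).
  apply/directv_sum_independent => u uP u0 b _.
  have [x _ ux] := memv_imgP (uP b isT).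
  have := congr1 (prj b) u0; rewrite linear0 linear_sum (bigD1 b) //= big1.
    by rewrite addr0 ux prjK => ->; rewrite linear0.
  by move=> a ab; have [y _ ->] := memv_imgP (uP a isT); rewrite prj0 // eq_sym.
rewrite /=; apply: eq_bigr => a _; apply: limg_dim_eq.
by rewrite (_ : lker _ = 0%VS) ?capv0 //; apply/eqP/lker0P/(can_inj (prjK a)).
Qed.

Section LinearCatTheory.
Variables (K : fieldType) (A : linearCat K).
Implicit Types X Y Z W : A.

Definition precomp X Y Z (f : hom X Y) (g : hom Y Z) : hom X Z := g \o f.
HB.instance Definition _ X Y Z (f : hom X Y) :=
  GRing.isLinear.Build K (hom Y Z) (hom X Z) *:%R (@precomp X Y Z f) (@comp_linl K A X Y Z f).
Definition postcomp X Y Z (g : hom Y Z) (f : hom X Y) : hom X Z := g \o f.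
HB.instance Definition _ X Y Z (g : hom Y Z) :=
  GRing.isLinear.Build K (hom X Y) (hom X Z) *:%R (@postcomp X Y Z g) (@comp_linr K A X Y Z g).

Lemma compBl X Y Z (f : hom X Y) (g h : hom Y Z) : (g - h) \o f = (g \o f) - (h \o f).
Proof. exact: (raddfB (@precomp X Y Z f)). Qed.
Lemma comp0l X Y Z (f : hom X Y) : (0 : hom Y Z) \o f = 0.
Proof. exact: (raddf0 (@precomp X Y Z f)). Qed.
Lemma compZl X Y Z (f : hom X Y) a (g : hom Y Z) : (a *: g) \o f = a *: (g \o f).
Proof. exact: (linearZ_LR (@precomp X Y Z f)). Qed.
Lemma comp_suml X Y Z (f : hom X Y) I r (P : pred I) (g : I -> hom Y Z) :
  (\sum_(i <- r | P i) g i) \o f = \sum_(i <- r | P i) (g i \o f).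
Proof. exact: (raddf_sum (@precomp X Y Z f)). Qed.
Lemma comp0r X Y Z (g : hom Y Z) : g \o (0 : hom X Y) = 0.
Proof. exact: (raddf0 (@postcomp X Y Z g)). Qed.
Lemma compZr X Y Z (g : hom Y Z) a (f : hom X Y) : g \o (a *: f) = a *: (g \o f).
Proof. exact: (linearZ_LR (@postcomp X Y Z g)). Qed.
Lemma comp_sumr X Y Z (g : hom Y Z) I r (P : pred I) (f : I -> hom X Y) :
  g \o (\sum_(i <- r | P i) f i) = \sum_(i <- r | P i) (g \o f i).
Proof. exact: (raddf_sum (@postcomp X Y Z g)). Qed.

(** Compositions are kept associated to the right; this and the next lemma
    rewrite the head of such a chain with an identity between composites. *)
Lemma comp_chain2 W X Y Z (h : hom Y Z) (g : hom X Y) (k : hom X Z) :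
  h \o g = k -> forall f : hom W X, h \o (g \o f) = k \o f.
Proof. by move=> <- f; rewrite compA. Qed.

Lemma comp_chain3 V W X Y Z (h : hom Y Z) (g : hom X Y) (k : hom W X) (l : hom W Z) :
  h \o (g \o k) = l -> forall f : hom V W, h \o (g \o (k \o f)) = l \o f.
Proof. by move=> <- f; rewrite !compA. Qed.

Lemma iso_refl X : isomorphic X X.
Proof. by exists (idm X), (idm X); rewrite comp1m. Qed.

Lemma iso_trans X Y Z : isomorphic X Y -> isomorphic Y Z -> isomorphic X Z.
Proof.
move=> [f [f' [f'f ff']]] [g [g' [g'g gg']]]; exists (g \o f), (f' \o g'); split.
  by rewrite -compA (compA g') g'g comp1m.
by rewrite -compA (compA f) ff' comp1m.
Qed.

Lemma dim_hom_isol X Y W : isomorphic X Y ->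
  \dim {: hom X W} = \dim {: hom Y W}.
Proof.
case=> f [g [gf fg]].
apply: (@dim_eq_cancel _ _ _ (linfun (@precomp Y X W g)) (linfun (@precomp X Y W f))).
  by move=> h; rewrite !lfunE /= /precomp -compA gf compm1.
by move=> h; rewrite !lfunE /= /precomp -compA fg compm1.
Qed.

Lemma dim_hom_isor X Y W : isomorphic X Y ->
  \dim {: hom W X} = \dim {: hom W Y}.
Proof.
case=> f [g [gf fg]].
apply: (@dim_eq_cancel _ _ _ (linfun (@postcomp W X Y f)) (linfun (@postcomp W Y X g))).
  by move=> h; rewrite !lfunE /= /postcomp compA gf comp1m.
by move=> h; rewrite !lfunE /= /postcomp compA fg comp1m.
Qed.

Lemma dim_hom_suml n (Y : 'I_n -> A) S W : is_direct_sum Y S ->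
  \dim {: hom S W} = (\sum_a \dim {: hom (Y a) W})%N.
Proof.
move=> [inj [prj [prjK prj0 sumE]]].
apply: (@dim_biproduct _ _ _ _ (fun a => linfun (@precomp S (Y a) W (prj a)))
   (fun a => linfun (@precomp (Y a) S W (inj a)))).
- by move=> a x; rewrite !lfunE /= /precomp -compA prjK compm1.
- by move=> a b x ab; rewrite !lfunE /= /precomp -compA prj0 1?eq_sym // comp0r.
move=> v; rewrite -[v in LHS]compm1 -sumE comp_sumr; apply: eq_bigr => a _.
by rewrite !lfunE /= /precomp compA.
Qed.

Lemma dim_hom_sumr n (Y : 'I_n -> A) S W : is_direct_sum Y S ->
  \dim {: hom W S} = (\sum_a \dim {: hom W (Y a)})%N.
Proof.
move=> [inj [prj [prjK prj0 sumE]]].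
apply: (@dim_biproduct _ _ _ _ (fun a => linfun (@postcomp W (Y a) S (inj a)))
   (fun a => linfun (@postcomp W S (Y a) (prj a)))).
- by move=> a x; rewrite !lfunE /= /postcomp compA prjK comp1m.
- by move=> a b x ab; rewrite !lfunE /= /postcomp compA prj0 // comp0l.
move=> v; rewrite -[v in LHS]comp1m -sumE comp_suml; apply: eq_bigr => a _.
by rewrite !lfunE /= /postcomp compA.
Qed.

(** The kernel of f is a proper subobject of X, hence zero, so f is mono and X is
    a nonzero subobject of Y. *)
Lemma schur_iso (hA : abelian A) X Y (f : hom X Y) :
  simple X -> simple Y -> f <> 0 -> is_iso f.
Proof.
move=> [X0 Xs] [Y0 Ys] f0.
have [W [k [fk kU]]] := ab_ker hA f.
have mono_k : mono k.
  move=> V g h gh.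
  have [u [_ uU]] : exists! u : hom V W, k \o u = k \o g.
    by apply: kU; rewrite compA fk comp0l.
  by rewrite -(uU g) // -(uU h).
have mono_f : mono f.
  case: (Xs W k mono_k) => [W0 | [k' [k'k kk']]]; last first.
    by case: f0; rewrite -[f]compm1 -kk' compA fk comp0l.
  move=> V g h gh.
  have [|u [ku _]] := kU V (g - h).
    by rewrite -[f \o _]/(postcomp f (g - h)) raddfB /= /postcomp gh subrr.
  by apply/eqP; rewrite -subr_eq0 -ku (W0 _ u) comp0r.
case: (Ys X f mono_f) => // X00; case: X0; exact: X00.
Qed.

Lemma hom_simple0 (hA : abelian A) X Y : simple X -> simple Y ->
  ~ isomorphic X Y -> \dim {: hom X Y} = 0%N.
Proof.
move=> sX sY nXY; apply/eqP; rewrite dimv_eq0 -subv0; apply/subvP => f _.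
rewrite memv0; apply/negPn/negP => /eqP f0.
by apply: nXY; exists f; apply: schur_iso.
Qed.

End LinearCatTheory.

Section Schur.
Variables (K : closedFieldType) (A : linearCat K).
Implicit Types X Y Z W : A.

(** Composition with f on the finite-dimensional space End X has an
    eigenvalue a, so f - a is not invertible, hence zero. *)
Lemma schur_scalar (hA : abelian A) X (f : hom X X) : simple X ->
  exists a : K, f = a *: idm X.
Proof.
move=> sX; have [X0 _] := sX.
pose e := vbasis {: hom X X}.
pose phi : 'End(hom X X) := linfun (@postcomp K A X X X f).
pose M := mxof e e phi.
have e_basis : basis_of fullv e by apply: vbasisP.
have dim_gt0 : (0 < \dim {: hom X X})%N.
  rewrite lt0n dimv_eq0; apply/eqP => full0; apply: X0; apply/eqP.
  by rewrite -memv0 -full0 memvf.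
have [a] : exists a, root (char_poly M) a.
  by apply/closed_rootP; rewrite size_char_poly eqSS -lt0n.
rewrite -eigenvalue_root_char => /eigenvalueP [v vM v0]; exists a.
pose g := vecof e v.
have gE : f \o g = a *: g.
  have : phi g = a *: g.
    by rewrite /g (@hom_vecof _ _ _ e e e_basis) vM linearZ.
  by rewrite lfunE.
have g0 : g <> 0 by move/eqP; rewrite /g (vecof_eq0 e_basis) (negPf v0).
apply/eqP; rewrite -subr_eq0; apply/eqP.
case: (eqVneq (f - a *: idm X) 0) => // /eqP /(schur_iso hA sX sX) [h [hf _]].
case: g0; rewrite -[g]comp1m -hf -compA compBl compZl comp1m gE subrr comp0r //.
Qed.

Lemma dim_end_simple (hA : abelian A) X : simple X -> \dim {: hom X X} = 1%N.
Proof.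
move=> sX; have [X0 _] := sX.
have -> : fullv = <[idm X]>%VS.
  apply: subv_anti; rewrite subvf andbT; apply/subvP => f _.
  by have [a ->] := schur_scalar hA f sX; rewrite memvZ ?memv_line.
by rewrite dim_vline; case: eqP X0.
Qed.

Lemma scalar_ofZ X (a : K) : idm X <> 0 -> scalar_of (a *: idm X) = a.
Proof.
move=> X0; rewrite /scalar_of linearZ /=.
rewrite (_ : coord _ _ _ = 1) ?mulr1 //.
have f : free [tuple idm X] by rewrite seq1_free; apply/eqP.
by have := coord_free ord0 ord0 f; rewrite /= => ->.
Qed.

Lemma scalar_ofE (hA : abelian A) X (f : hom X X) : simple X ->
  f = scalar_of f *: idm X.
Proof.
move=> sX; have [a ->] := schur_scalar hA f sX.
by rewrite scalar_ofZ //; case: sX.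
Qed.

End Schur.

(** * Tensor product functors *)

Local Notation "A *> f" := (tensm (idm A) f) (at level 38, right associativity) : cat_scope.
Local Notation "f <* Z" := (tensm f (idm Z)) (at level 39, left associativity) : cat_scope.

Section MonoidalTheory.
Variables (K : fieldType) (C : monoidalCat K).
Implicit Types A B P Q W X Y Z : C.

Lemma lwD A X Y Z (g : hom Y Z) (f : hom X Y) : A *> (g \o f) = (A *> g) \o (A *> f).
Proof. by rewrite -tensm_comp comp1m. Qed.

Lemma rwD A X Y Z (g : hom Y Z) (f : hom X Y) : (g \o f) <* A = (g <* A) \o (f <* A).
Proof. by rewrite -tensm_comp comp1m. Qed.

Lemma whisker_swap A A' Z Z' (f : hom A A') (g : hom Z Z') :
  (A' *> g) \o (f <* Z) = (f <* Z') \o (A *> g).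
Proof. by rewrite -!tensm_comp !comp1m !compm1. Qed.

Lemma assoc_lw A B Z Z' (f : hom Z Z') :
  assoc A B Z' \o ((A \ot B) *> f) = (A *> B *> f) \o assoc A B Z.
Proof. by rewrite -tensm_id assoc_nat. Qed.

Lemma assoc_mw A B B' Z (f : hom B B') :
  assoc A B' Z \o ((A *> f) <* Z) = (A *> (f <* Z)) \o assoc A B Z.
Proof. exact: assoc_nat. Qed.

Lemma assoc_rw A A' B Z (f : hom A A') :
  assoc A' B Z \o ((f <* B) <* Z) = (f <* (B \ot Z)) \o assoc A B Z.
Proof. by rewrite -[idm (B \ot Z)]tensm_id assoc_nat. Qed.

(** Turns a naturality square of assoc into one of assocV. *)
Lemma assoc_conj A B Z A' B' Z' (f : hom ((A \ot B) \ot Z) ((A' \ot B') \ot Z')) g :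
  assoc A' B' Z' \o f = g \o assoc A B Z -> assocV A' B' Z' \o g = f \o assocV A B Z.
Proof.
move=> E; rewrite -[g]compm1 -(assocVK A B Z) (compA g) -E !compA assocK comp1m //.
Qed.

Lemma assocV_lw A B Z Z' (f : hom Z Z') :
  assocV A B Z' \o (A *> B *> f) = ((A \ot B) *> f) \o assocV A B Z.
Proof. by apply: assoc_conj; rewrite assoc_lw. Qed.

Lemma assocV_mw A B B' Z (f : hom B B') :
  assocV A B' Z \o (A *> (f <* Z)) = ((A *> f) <* Z) \o assocV A B Z.
Proof. by apply: assoc_conj; rewrite assoc_mw. Qed.

Lemma assocV_rw A A' B Z (f : hom A A') :
  assocV A' B Z \o (f <* (B \ot Z)) = ((f <* B) <* Z) \o assocV A B Z.
Proof. by apply: assoc_conj; rewrite assoc_rw. Qed.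

Lemma lw_assocK A X Y Z : (A *> assocV X Y Z) \o (A *> assoc X Y Z) = idm _.
Proof. by rewrite -lwD assocK tensm_id. Qed.
Lemma lw_assocVK A X Y Z : (A *> assoc X Y Z) \o (A *> assocV X Y Z) = idm _.
Proof. by rewrite -lwD assocVK tensm_id. Qed.
Lemma rw_assocK A X Y Z : (assocV X Y Z <* A) \o (assoc X Y Z <* A) = idm _.
Proof. by rewrite -rwD assocK tensm_id. Qed.
Lemma rw_assocVK A X Y Z : (assoc X Y Z <* A) \o (assocV X Y Z <* A) = idm _.
Proof. by rewrite -rwD assocVK tensm_id. Qed.

Lemma pentagonV W X Y Z :
  assocV (W \ot X) Y Z \o assocV W X (Y \ot Z) =
  (assocV W X Y <* Z) \o (assocV W (X \ot Y) Z \o (W *> assocV X Y Z)).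
Proof.
set u := RHS; rewrite -[LHS]comp1m.
have <- : u \o (assoc W X (Y \ot Z) \o assoc (W \ot X) Y Z) = idm _.
  rewrite pentagon /u -?compA (comp_chain2 (lw_assocK _ _ _ _)) comp1m.
  by rewrite (comp_chain2 (assocK _ _ _)) comp1m rw_assocK.
by rewrite -?compA (comp_chain2 (assocVK _ _ _)) comp1m assocVK compm1.
Qed.

Lemma pentagon_chain T W X Y Z (f : hom T (((W \ot X) \ot Y) \ot Z)) :
  (W *> assoc X Y Z) \o (assoc W (X \ot Y) Z \o ((assoc W X Y <* Z) \o f)) =
  assoc W X (Y \ot Z) \o (assoc (W \ot X) Y Z \o f).
Proof. by rewrite !compA -(compA _ _ (_ <* Z)) -pentagon. Qed.

(** Two rearrangements of the pentagon, for pushing associators to the right. *)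
Lemma pentagon_mid W X Y Z : (W *> assocV X Y Z) \o assoc W X (Y \ot Z) =
  assoc W (X \ot Y) Z \o ((assoc W X Y <* Z) \o assocV (W \ot X) Y Z).
Proof.
rewrite -[LHS]compm1 -(assocVK (W \ot X) Y Z) -?compA (compA (assoc W X _)) pentagon.
by rewrite -?compA (comp_chain2 (lw_assocK _ _ _ _)) comp1m.
Qed.

Lemma pentagonV_mid W X Y Z : assocV W X (Y \ot Z) \o (W *> assoc X Y Z) =
  assoc (W \ot X) Y Z \o ((assocV W X Y <* Z) \o assocV W (X \ot Y) Z).
Proof.
rewrite -[LHS]comp1m -(assocVK (W \ot X) Y Z) -?compA (comp_chain2 (pentagonV _ _ _ _)).
by rewrite -?compA lw_assocK compm1.
Qed.

Lemma lunit_inv_ex X : exists g : hom X (unit_ob C \ot X),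
  (g \o lunit X == idm _) && (lunit X \o g == idm _).
Proof. by have [g [gl lg]] := lunit_iso X; exists g; rewrite gl lg !eqxx. Qed.

Definition lunitV X := xchoose (lunit_inv_ex X).

Lemma lunitK X : lunitV X \o lunit X = idm _.
Proof. by have /andP[/eqP] := xchooseP (lunit_inv_ex X). Qed.

Lemma lunitVK X : lunit X \o lunitV X = idm _.
Proof. by have /andP[_ /eqP] := xchooseP (lunit_inv_ex X). Qed.

Lemma lunitV_nat X Y (f : hom X Y) : lunitV Y \o f = (unit_ob C *> f) \o lunitV X.
Proof.
rewrite -[f in LHS]compm1 -(lunitVK X) (compA f) -lunit_nat -compA.
by rewrite (comp_chain2 (lunitK _)) comp1m.
Qed.

(** Tensoring with the unit is naturally isomorphic to the identity functor. *)
Lemma lw_unit_inj X Y (f g : hom X Y) : unit_ob C *> f = unit_ob C *> g -> f = g.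
Proof.
move=> fg; have := congr1 (fun h => lunit Y \o (h \o lunitV X)) fg.
by rewrite /= !compA !lunit_nat -?compA lunitVK !compm1.
Qed.

(** Kelly's argument: after tensoring with the unit on the left, the pentagon
    on 1, 1, A, Z reduces this to two instances of the triangle. *)
Lemma lunit_tens A Z : lunit (A \ot Z) \o assoc (unit_ob C) A Z = lunit A <* Z.
Proof.
set I := unit_ob C; apply: lw_unit_inj.
have cancel (f g : hom (I \ot ((I \ot A) \ot Z)) (I \ot (A \ot Z))) :
    f \o (assoc I (I \ot A) Z \o (assoc I I A <* Z)) =
    g \o (assoc I (I \ot A) Z \o (assoc I I A <* Z)) -> f = g.
  move/(congr1 (fun h => h \o ((assocV I I A <* Z) \o assocV I (I \ot A) Z))).
  rewrite -?compA !(comp_chain2 (rw_assocVK _ _ _ _)) !comp1m.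
  by rewrite !assocVK !compm1.
apply: cancel; rewrite lwD -?compA -pentagon.
rewrite (comp_chain2 (triangle _ _)) -assoc_rw -triangle rwD compA assoc_mw.
by rewrite -?compA.
Qed.

Lemma lunitV_tens A Z : assocV (unit_ob C) A Z \o lunitV (A \ot Z) = lunitV A <* Z.
Proof.
rewrite -[LHS]comp1m -[idm _]tensm_id -(lunitK A) rwD -lunit_tens -?compA.
by rewrite (comp_chain2 (assocVK _ _ _)) comp1m lunitVK compm1.
Qed.

Lemma triangle_inv X Y :
  (runit X <* Y) \o (assocV X (unit_ob C) Y \o (X *> lunitV Y)) = idm _.
Proof.
rewrite -triangle -?compA (comp_chain2 (assocVK _ _ _)) comp1m -lwD.
by rewrite lunitVK tensm_id.
Qed.

(** A morphism P (x) Q -> 1 is turned into a transformation from the composite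
    of P (x) - and Q (x) - to the identity functor, and dually for a morphism
    1 -> P (x) Q.  Both are locked: composites would otherwise be unfolded when
    chains of compositions are reassociated. *)
Section CupCap.
Variables P Q : C.

Definition cap (m : hom (P \ot Q) (unit_ob C)) Z : hom (P \ot (Q \ot Z)) Z :=
  locked (lunit Z \o ((m <* Z) \o assocV P Q Z)).

Definition cup (c : hom (unit_ob C) (P \ot Q)) Z : hom Z (P \ot (Q \ot Z)) :=
  locked (assoc P Q Z \o ((c <* Z) \o lunitV Z)).

Lemma capE m Z : cap m Z = lunit Z \o ((m <* Z) \o assocV P Q Z).
Proof. by rewrite /cap -lock. Qed.
Lemma cupE c Z : cup c Z = assoc P Q Z \o ((c <* Z) \o lunitV Z).
Proof. by rewrite /cup -lock. Qed.

Variables (m : hom (P \ot Q) (unit_ob C)) (c : hom (unit_ob C) (P \ot Q)).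

Lemma cap_nat Y Z (f : hom Y Z) : cap m Z \o (P *> Q *> f) = f \o cap m Y.
Proof.
rewrite !capE -?compA assocV_lw (comp_chain2 (esym (whisker_swap _ _))) -?compA.
by rewrite (comp_chain2 (lunit_nat _)) -?compA.
Qed.

Lemma cup_nat Y Z (f : hom Y Z) : (P *> Q *> f) \o cup c Y = cup c Z \o f.
Proof.
rewrite !cupE -?compA lunitV_nat (comp_chain2 (esym (whisker_swap _ _))) -?compA.
by rewrite (comp_chain2 (assoc_lw _ _ _)) -?compA.
Qed.

(** The component at Y (x) Z is the one at Y, tensored with Z on the right. *)
Lemma cap_tens Y Z : cap m (Y \ot Z) =
  (cap m Y <* Z) \o (assocV P (Q \ot Y) Z \o (P *> assocV Q Y Z)).
Proof.
rewrite !capE !rwD -?compA -pentagonV -lunit_tens -?compA.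
rewrite (comp_chain2 (esym (assocV_rw _ _ _))) -?compA.
by rewrite (comp_chain2 (assocVK _ _ _)) comp1m.
Qed.

Lemma cup_tens Y Z : cup c (Y \ot Z) =
  (P *> assoc Q Y Z) \o (assoc P (Q \ot Y) Z \o (cup c Y <* Z)).
Proof.
rewrite !cupE !rwD -?compA -lunitV_tens pentagon_chain.
rewrite (comp_chain2 (esym (assocV_rw _ _ _))) -?compA.
by rewrite (comp_chain2 (assocVK _ _ _)) comp1m.
Qed.

End CupCap.

Section Duality.
Variables (X Y : C) (e : hom (Y \ot X) (unit_ob C)) (c : hom (unit_ob C) (X \ot Y)).
Hypothesis XY : is_dual e c.

(** The defining identities of a dual pair, now free of unitors and associators. *)
Lemma zigzag1 Z : (X *> cap e Z) \o cup c (X \ot Z) = idm (X \ot Z).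
Proof.
have [zz _] := XY.
rewrite !capE !cupE !lwD -?compA.
rewrite (comp_chain2 (pentagon_mid _ _ _ _)) -?compA.
rewrite (comp_chain2 (assocV_rw _ _ _)) -?compA lunitV_tens.
rewrite (comp_chain2 (esym (assoc_mw _ _ _))) -?compA (comp_chain2 (triangle _ _)) -!rwD.
transitivity ((lunit X \o lunitV X) <* Z); last by rewrite lunitVK tensm_id.
by rewrite -zz -?compA.
Qed.

Lemma zigzag2 Z : cap e (Y \ot Z) \o (Y *> cup c Z) = idm (Y \ot Z).
Proof.
have [_ zz] := XY.
rewrite !capE !cupE !lwD -?compA.
rewrite (comp_chain2 (pentagonV_mid _ _ _ _)) -?compA (comp_chain2 (assocV_mw _ _ _)) -?compA.
rewrite (comp_chain2 (esym (assoc_rw _ _ _))) -?compA (comp_chain2 (lunit_tens _ _)).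
rewrite -(triangle_inv Y Z) -zz !rwD -?compA //.
Qed.

(** The functor Y (x) - is left adjoint to X (x) -, by the zigzag identities. *)
Lemma dim_hom_adj T Z : \dim {: hom (Y \ot T) Z} = \dim {: hom T (X \ot Z)}.
Proof.
pose F (f : hom (Y \ot T) Z) := (X *> f) \o cup c T.
pose G (g : hom T (X \ot Z)) := cap e Z \o (Y *> g).
have linF : linear F by move=> a f g; rewrite /F tensm_linr comp_linl.
have linG : linear G by move=> a f g; rewrite /G tensm_linr comp_linr.
pose FL := GRing.isLinear.Build K _ _ _ F linF.
pose GL := GRing.isLinear.Build K _ _ _ G linG.
pose F' : {linear _ -> _} := HB.pack F FL.
pose G' : {linear _ -> _} := HB.pack G GL.
apply: (@dim_eq_cancel _ _ _ (linfun F') (linfun G')) => f; rewrite !lfunE /= /F /G.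
  by rewrite lwD compA cap_nat -compA zigzag2 compm1.
by rewrite lwD -compA cup_nat compA zigzag1 comp1m.
Qed.

End Duality.

Definition lwhisk A X Y (f : hom X Y) : hom (A \ot X) (A \ot Y) := A *> f.
HB.instance Definition _ A X Y :=
  GRing.isLinear.Build K (hom X Y) (hom (A \ot X) (A \ot Y)) *:%R (@lwhisk A X Y)
    (@tensm_linr K C A A X Y (idm A)).
Definition rwhisk A X Y (f : hom X Y) : hom (X \ot A) (Y \ot A) := f <* A.
HB.instance Definition _ A X Y :=
  GRing.isLinear.Build K (hom X Y) (hom (X \ot A) (Y \ot A)) *:%R (@rwhisk A X Y)
    (@tensm_linl K C X Y A A (idm A)).

Lemma lwZ A X Y a (f : hom X Y) : A *> (a *: f) = a *: (A *> f).
Proof. exact: (linearZ_LR (@lwhisk A X Y)). Qed.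
Lemma rwZ A X Y a (f : hom X Y) : (a *: f) <* A = a *: (f <* A).
Proof. exact: (linearZ_LR (@rwhisk A X Y)). Qed.

Lemma direct_sum_tensr n (Y : 'I_n -> C) S A : is_direct_sum Y S ->
  is_direct_sum (fun a => Y a \ot A) (S \ot A).
Proof.
move=> [inj [prj [prjK prj0 sumE]]].
exists (fun a => inj a <* A), (fun a => prj a <* A); split.
- by move=> a; rewrite -rwD prjK tensm_id.
- by move=> a b ab; rewrite -rwD prj0 //; exact: (raddf0 (@rwhisk A _ _)).
rewrite -tensm_id -sumE.
rewrite -[RHS]/(rwhisk A (\sum_k (inj k \o prj k))) raddf_sum.
by apply: eq_bigr => a _; rewrite -rwD.
Qed.

Lemma iso_tens X X' Y Y' : isomorphic X X' -> isomorphic Y Y' ->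
  isomorphic (X \ot Y) (X' \ot Y').
Proof.
move=> [f [f' [f'f ff']]] [g [g' [g'g gg']]]; exists (f \otm g), (f' \otm g').
by rewrite -!tensm_comp f'f ff' g'g gg' !tensm_id.
Qed.

Lemma iso_lunit X : isomorphic (unit_ob C \ot X) X.
Proof. by exists (lunit X); apply: lunit_iso. Qed.

End MonoidalTheory.

(** * Braidings *)

Section BraidedTheory.
Variables (K : fieldType) (C : braidedCat K).
Implicit Types A B P Q W X Y Z : C.

(** The braiding as a natural transformation between composite functors; locked
    for the same reason as cap and cup. *)
Definition br A B Z : hom (A \ot (B \ot Z)) (B \ot (A \ot Z)) :=
  locked (assoc B A Z \o ((braid A B <* Z) \o assocV A B Z)).

Lemma brE A B Z :
  br A B Z = assoc B A Z \o ((braid A B <* Z) \o assocV A B Z).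
Proof. by rewrite /br -lock. Qed.

Lemma br_nat A B Y Z (f : hom Y Z) :
  (B *> A *> f) \o br A B Y = br A B Z \o (A *> B *> f).
Proof.
rewrite !brE -?compA assocV_lw (comp_chain2 (esym (whisker_swap _ _))) -?compA.
by rewrite (comp_chain2 (assoc_lw _ _ _)) -?compA.
Qed.

Lemma br_natl A A' B Z (u : hom A A') :
  (B *> (u <* Z)) \o br A B Z = br A' B Z \o (u <* (B \ot Z)).
Proof.
rewrite !brE -?compA assocV_rw (comp_chain2 (esym (assoc_mw _ _ _))) -?compA.
by rewrite !(comp_chain2 (esym (rwD _ _ _))) braid_nat.
Qed.

Lemma br_natr A B B' Z (v : hom B B') :
  (v <* (A \ot Z)) \o br A B Z = br A B' Z \o (A *> (v <* Z)).
Proof.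
rewrite !brE -?compA assocV_mw (comp_chain2 (esym (assoc_rw _ _ _))) -?compA.
by rewrite !(comp_chain2 (esym (rwD _ _ _))) braid_nat.
Qed.

(** The hexagons: to cross P (x) Q is to cross its two factors in turn. *)
Lemma br_tensr X P Q Z : assoc P Q (X \ot Z) \o br X (P \ot Q) Z =
  (P *> br X Q Z) \o (br X P (Q \ot Z) \o (X *> assoc P Q Z)).
Proof.
rewrite !brE !lwD -?compA (compA (assoc P Q _)) pentagon -?compA.
congr (_ \o _).
rewrite (comp_chain2 (pentagon_mid _ _ _ _)) -?compA.
rewrite (comp_chain2 (esym (assoc_mw _ _ _))) -?compA.
rewrite (comp_chain2 (assocV_rw _ _ _)) -?compA pentagonV_mid.
rewrite (comp_chain2 (assocK _ _ _)) comp1m; congr (_ \o _).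
rewrite !(comp_chain2 (esym (rwD _ _ _))) -?compA.
have E : assoc P Q X \o braid X (P \ot Q) =
  (P *> braid X Q) \o (assoc P X Q \o ((braid X P <* Q) \o assocV X P Q)).
  by rewrite -[LHS]compm1 -(assocVK X P Q) compA -(compA (assoc P Q X)) hexagon1 -?compA.
by rewrite E -?compA.
Qed.

Lemma br_tensl P Q Y Z : (Y *> assoc P Q Z) \o br (P \ot Q) Y Z =
  br P Y (Q \ot Z) \o ((P *> br Q Y Z) \o assoc P Q (Y \ot Z)).
Proof.
have E : braid (P \ot Q) Y = assoc Y P Q \o ((braid P Y <* Q) \o
    (assocV P Y Q \o ((P *> braid Q Y) \o assoc P Q Y))).
  rewrite -[LHS]compm1 -(assocK P Q Y) -[LHS]comp1m -(assocVK Y P Q) -?compA.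
  congr (_ \o _); rewrite (compA _ (assocV P Q Y)) (compA (assocV Y P Q)) hexagon2.
  by rewrite -?compA.
rewrite !brE E !rwD !lwD -?compA pentagon_chain (comp_chain2 (assoc_rw _ _ _)) -?compA.
congr (_ \o (_ \o _)).
rewrite (comp_chain2 (pentagonV_mid _ _ _ _)) -?compA; congr (_ \o (_ \o _)).
rewrite (comp_chain2 (assocV_mw _ _ _)) -?compA; congr (_ \o _).
have := pentagonV P Q Y Z.
move/(congr1 (fun h => (assoc P Q Y <* Z) \o (h \o assoc P Q (Y \ot Z)))).
rewrite /= -?compA assocK compm1 => ->.
by rewrite (comp_chain2 (rw_assocVK _ _ _ _)) comp1m.
Qed.

Lemma br_iso A B Z : exists g, g \o br A B Z = idm _ /\ br A B Z \o g = idm _.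
Proof.
have [g [gb bg]] := braid_iso A B.
exists (assoc A B Z \o ((g <* Z) \o assocV B A Z)); split; rewrite !brE -?compA.
  rewrite (comp_chain2 (assocK _ _ _)) comp1m (comp_chain2 (esym (rwD _ _ _))) gb tensm_id comp1m.
  by rewrite assocVK.
rewrite (comp_chain2 (assocK _ _ _)) comp1m (comp_chain2 (esym (rwD _ _ _))) bg tensm_id comp1m.
by rewrite assocVK.
Qed.

(** By the hexagon, crossing 1 (x) 1 is crossing 1 twice; as 1 (x) 1 is
    isomorphic to 1, crossing 1 is idempotent up to unitors, and it is
    invertible. *)
Lemma br_unit X Z : lunit (X \ot Z) \o br X (unit_ob C) Z = X *> lunit Z.
Proof.
set I := unit_ob C; apply: lw_unit_inj; rewrite lwD.
have E : br X I Z \o (X *> I *> lunit Z) =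
   (I *> lunit (X \ot Z)) \o ((I *> br X I Z) \o br X I (I \ot Z)).
  rewrite -[LHS]compm1 -(lw_assocVK X I I Z) -?compA -!lwD.
  rewrite (compA (I *> lunit Z)) triangle (lwD X (_ <* Z)).
  rewrite (comp_chain2 (esym (br_natr _ _ _))) -?compA -triangle -?compA.
  by rewrite (comp_chain2 (br_tensr _ _ _ _)) -?compA lw_assocVK compm1.
move: E; rewrite -br_nat compA.
have [g [_ bg]] := br_iso X I (I \ot Z).
by move/(congr1 (fun h => h \o g)); rewrite -?compA bg !compm1 => <-.
Qed.

Lemma br_unitV X Z : br X (unit_ob C) Z \o (X *> lunitV Z) = lunitV (X \ot Z).
Proof.
rewrite -[LHS]comp1m -(lunitK (X \ot Z)) -?compA (comp_chain2 (br_unit _ _)) -lwD.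
by rewrite lunitVK tensm_id compm1.
Qed.

(** A strand X slides over a cup or a cap, by naturality of the braiding in the
    morphism to or from the unit, which X crosses trivially. *)
Lemma cup_slide P Q (c : hom (unit_ob C) (P \ot Q)) X Z :
  (P *> br X Q Z) \o (br X P (Q \ot Z) \o (X *> cup c Z)) = cup c (X \ot Z).
Proof.
rewrite !cupE !lwD (compA (br X P _)) (compA (P *> _)) -br_tensr -?compA.
by rewrite (comp_chain2 (esym (br_natr _ _ _))) -?compA br_unitV.
Qed.

Lemma cap_slide P Q (m : hom (P \ot Q) (unit_ob C)) X Z :
  cap m (X \ot Z) \o ((P *> br X Q Z) \o br X P (Q \ot Z)) = X *> cap m Z.
Proof.
rewrite !capE !lwD -br_unit -?compA; congr (_ \o _).
rewrite (comp_chain2 (esym (br_natr _ _ _))) -?compA; congr (_ \o _).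
rewrite -[RHS]comp1m -(assocK P Q (X \ot Z)) -?compA; congr (_ \o _).
by rewrite (comp_chain2 (br_tensr _ _ _ _)) -?compA lw_assocVK compm1.
Qed.

(** Naturality of the crossing of A (x) B and D in the braiding of A and B. *)
Lemma yang_baxter A B D Z :
  (D *> br A B Z) \o (br A D (B \ot Z) \o (A *> br B D Z)) =
  br B D (A \ot Z) \o ((B *> br A D Z) \o br A B (D \ot Z)).
Proof.
have E : br A D (B \ot Z) \o (A *> br B D Z) =
    (D *> assoc A B Z) \o (br (A \ot B) D Z \o assocV A B (D \ot Z)).
  by rewrite (comp_chain2 (br_tensl _ _ _ _)) -?compA assocVK compm1.
have E' T (f : hom T _) : br B D (A \ot Z) \o ((B *> br A D Z) \o (assoc B A (D \ot Z) \o f)) =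
    (D *> assoc B A Z) \o (br (B \ot A) D Z \o f).
  by rewrite (comp_chain2 (br_tensl _ _ _ _)) -?compA.
rewrite E (brE A B Z) (brE A B (D \ot Z)) E' !lwD -?compA.
rewrite (comp_chain2 (lw_assocK _ _ _ _)) comp1m.
by rewrite (comp_chain2 (br_natl _ _ _)) -?compA.
Qed.

End BraidedTheory.

(** * Partial traces *)

Section RibbonTheory.
Variables (K : fieldType) (C : ribbonCat K).
Implicit Types A B P Q W X Y Z : C.

Definition eval A Z : hom (dual A \ot (A \ot Z)) Z := cap (ev A) Z.
Definition coeval A Z : hom Z (A \ot (dual A \ot Z)) := cup (coev A) Z.

(** The twist makes the left dual of A also a right dual: this is the other
    coevaluation.  Its choice is dictated by the definition of the quantum
    trace. *)
Definition coev_right A : hom (unit_ob C) (dual A \ot A) :=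
  braid A (dual A) \o ((twist A <* dual A) \o coev A).
Definition kappa A Z : hom Z (dual A \ot (A \ot Z)) := cup (coev_right A) Z.

Lemma kappaE A Z : kappa A Z = br A (dual A) Z \o ((twist A <* (dual A \ot Z)) \o coeval A Z).
Proof.
rewrite /kappa /coeval !cupE brE !rwD -?compA; congr (_ \o (_ \o _)).
by rewrite (comp_chain2 (esym (assoc_rw _ _ _))) -?compA (comp_chain2 (assocK _ _ _)) comp1m.
Qed.

Lemma kappa_nat A Y Z (f : hom Y Z) : (dual A *> A *> f) \o kappa A Y = kappa A Z \o f.
Proof. exact: cup_nat. Qed.

Lemma coeval_nat A Y Z (f : hom Y Z) : (A *> dual A *> f) \o coeval A Y = coeval A Z \o f.
Proof. exact: cup_nat. Qed.

Lemma eval_nat A Y Z (f : hom Y Z) : eval A Z \o (dual A *> A *> f) = f \o eval A Y.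
Proof. exact: cap_nat. Qed.

Lemma eval_coeval A Z : (A *> eval A Z) \o coeval A (A \ot Z) = idm _.
Proof. exact/zigzag1/left_dual. Qed.

(** The strand A is closed on the left.  For Z the unit this is the quantum trace
    (see qtraceE). *)
Definition ptr A Z (f : hom (A \ot Z) (A \ot Z)) : hom Z Z :=
  locked (eval A Z \o ((dual A *> f) \o kappa A Z)).

Lemma ptrE A Z (f : hom (A \ot Z) (A \ot Z)) :
  ptr f = eval A Z \o ((dual A *> f) \o kappa A Z).
Proof. by rewrite /ptr -lock. Qed.

Lemma ptr_nat A Y Z (u : hom Z Y) (g : hom (A \ot Z) (A \ot Z)) (v : hom Y Z) :
  ptr ((A *> u) \o (g \o (A *> v))) = u \o (ptr g \o v).
Proof.
rewrite !ptrE !lwD -?compA kappa_nat (comp_chain2 (eval_nat _ _)) -?compA //.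
Qed.

(** A family g_Z : Z -> P (x) F Z is transposed into a family from P^* (x) Z to
    F Z, where P^* is the dual of P.  Here F stands for tensoring with a dual
    object, or with two of them, and sigma moves a strand across these.  In
    both uses g_Z is a fixed morphism tensored with Z; the hypotheses record
    what this gives, up to associators. *)
Section Transpose.
Variables (P : C) (F : C -> C) (Fm : forall Y Z, hom Y Z -> hom (F Y) (F Z)).
Variable sigma : forall X Z, hom (X \ot F Z) (F (X \ot Z)).
Variable g : forall Z, hom Z (P \ot F Z).
Hypothesis g_nat : forall Y Z (f : hom Y Z), (P *> Fm f) \o g Y = g Z \o f.
Hypothesis g_slide : forall X Z,
  (P *> sigma X Z) \o (br X P (F Z) \o (X *> g Z)) = g (X \ot Z).

Definition transpose Z : hom (dual P \ot Z) (F Z) :=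
  locked (eval P (F Z) \o (dual P *> g Z)).

Lemma transposeE Z : transpose Z = eval P (F Z) \o (dual P *> g Z).
Proof. by rewrite /transpose -lock. Qed.

Lemma transpose_nat Y Z (f : hom Y Z) :
  Fm f \o transpose Y = transpose Z \o (dual P *> f).
Proof.
by rewrite !transposeE compA -eval_nat -?compA -!lwD g_nat.
Qed.

Lemma transpose_slide X Z :
  transpose (X \ot Z) \o br X (dual P) Z = sigma X Z \o (X *> transpose Z).
Proof.
rewrite !transposeE -g_slide !lwD -?compA br_nat.
rewrite (comp_chain2 (eval_nat _ _)) -?compA; congr (_ \o _).
have := cap_slide (ev P) X (F Z); rewrite -/(eval P (F Z)) => <-.
by rewrite -?compA.
Qed.

Lemma transpose_coeval Z : (P *> transpose Z) \o coeval P Z = g Z.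
Proof.
rewrite !transposeE !lwD -?compA coeval_nat.
by rewrite (comp_chain2 (eval_coeval _ _)) comp1m.
Qed.

(** The transpose also relates the other coevaluations, because the braiding in
    kappa lets the transpose slide past P. *)
Lemma transpose_kappa Z :
  transpose (P \ot Z) \o kappa P Z = sigma P Z \o ((twist P <* F Z) \o g Z).
Proof.
rewrite kappaE (comp_chain2 (transpose_slide _ _)) -?compA.
by rewrite (comp_chain2 (whisker_swap _ _)) -?compA transpose_coeval.
Qed.

End Transpose.

Lemma br_coeval A X Z :
  (A *> br X (dual A) Z) \o (br X A (dual A \ot Z) \o (X *> coeval A Z)) = coeval A (X \ot Z).
Proof. exact: cup_slide. Qed.

(** Moving u around the closed strand: the transpose of u carries the evaluation
    and coevaluation of B to those of A, with u inserted. *)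
Lemma ptr_cyclic A B Z (u : hom A B) (f : hom (B \ot Z) (A \ot Z)) :
  ptr ((u <* Z) \o f) = ptr (f \o (u <* Z)).
Proof.
pose g Z : hom Z (B \ot (dual A \ot Z)) := (u <* (dual A \ot Z)) \o coeval A Z.
have g_nat Y X (h : hom Y X) : (B *> dual A *> h) \o g Y = g X \o h.
  rewrite /g (comp_chain2 (whisker_swap _ _)) -?compA; congr (_ \o _); exact: coeval_nat.
have g_slide X W : (B *> br X (dual A) W) \o (br X B (dual A \ot W) \o (X *> g W)) = g (X \ot W).
  rewrite /g lwD -br_coeval (comp_chain2 (esym (br_natr _ _ _))) -?compA.
  by rewrite (comp_chain2 (whisker_swap _ _)) -?compA.
have H1 : eval A Z \o transpose g (A \ot Z) = eval B Z \o (dual B *> (u <* Z)).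
  rewrite !transposeE compA -eval_nat -?compA -!lwD.
  rewrite /g (comp_chain2 (whisker_swap _ _)) -?compA eval_coeval compm1 //.
have H2 : transpose g (B \ot Z) \o kappa B Z = (dual A *> (u <* Z)) \o kappa A Z.
  rewrite (transpose_kappa (sigma := fun X Z => br X (dual A) Z)) // /g.
  rewrite (comp_chain2 (esym (rwD _ _ _))) twist_nat rwD -?compA.
  by rewrite (comp_chain2 (esym (br_natl _ _ _))) -?compA -kappaE.
rewrite !ptrE !lwD -?compA -H2 (comp_chain2 (esym H1)) -?compA; congr (_ \o _).
by rewrite (comp_chain2 (transpose_nat (Fm := fun Y Z h => dual A *> h) g_nat f)) -?compA.
Qed.

Lemma twist_tens_br A B Z : (twist (A \ot B) <* Z) \o assocV A B Z = assocV A B Z \o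
  (br B A Z \o (br A B Z \o ((twist A <* (B \ot Z)) \o (A *> (twist B <* Z))))).
Proof.
have -> : twist (A \ot B) =
    braid B A \o (braid A B \o ((twist A <* B) \o (A *> twist B))).
  by rewrite twist_tens -[X in _ = _ \o (_ \o X)]tensm_comp compm1 comp1m.
rewrite !brE !rwD -?compA (comp_chain2 (assocK _ _ _)) comp1m.
rewrite (comp_chain2 (assocK _ _ _)) comp1m; congr (_ \o (_ \o _)).
by rewrite (comp_chain2 (assocV_rw _ _ _)) -?compA assocV_mw.
Qed.

(** Write V^* for the dual of V, and P for A (x) B.  The transpose is here the
    isomorphism from P^* to B^* (x) A^*.  It carries the evaluation of P to
    those of A and B by the zigzag identities, and the coevaluation kappa of P
    to those of A and B by the formula for the twist of A (x) B, whose double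
    braiding is absorbed when A slides over kappa B and B over kappa A. *)
Lemma ptr_tens A B Z (f : hom (A \ot (B \ot Z)) (A \ot (B \ot Z))) :
  ptr (assocV A B Z \o (f \o assoc A B Z)) = ptr (ptr f).
Proof.
set P := A \ot B.
pose F Z := dual B \ot (dual A \ot Z).
pose sigma X Z : hom (X \ot F Z) (F (X \ot Z)) :=
  (dual B *> br X (dual A) Z) \o br X (dual B) (dual A \ot Z).
pose g Z : hom Z (P \ot F Z) :=
  assocV A B (F Z) \o ((A *> coeval B (dual A \ot Z)) \o coeval A Z).
have g_nat Y X (h : hom Y X) : (P *> dual B *> dual A *> h) \o g Y = g X \o h.
  rewrite /g (comp_chain2 (esym (assocV_lw _ _ _))) -?compA; congr (_ \o _).
  rewrite (comp_chain2 (esym (lwD _ _ _))) coeval_nat lwD -?compA.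
  congr (_ \o _); exact: coeval_nat.
have g_slide X W : (P *> sigma X W) \o (br X P (F W) \o (X *> g W)) = g (X \ot W).
  have E : br X P (F W) \o (X *> assocV A B (F W)) =
      assocV A B (X \ot F W) \o ((A *> br X B (F W)) \o br X A (B \ot F W)).
    rewrite -[LHS]comp1m -(assocK A B (X \ot F W)) -?compA; congr (_ \o _).
    by rewrite (comp_chain2 (br_tensr _ _ _ _)) -?compA lw_assocVK compm1.
  rewrite /g !lwD (comp_chain2 E) -?compA (comp_chain2 (esym (assocV_lw _ _ _))) -?compA.
  rewrite (comp_chain2 (esym (assocV_lw _ _ _))) -?compA; congr (_ \o _).
  rewrite (comp_chain2 (esym (br_nat _ _ _))) -?compA -?lwD.
  rewrite -(br_coeval A X W) !(comp_chain2 (esym (lwD _ _ _))) -?compA.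
  by rewrite br_coeval -coeval_nat -?compA.
pose phi := transpose g.
have phi_nat Y X (h : hom Y X) : (dual B *> dual A *> h) \o phi Y = phi X \o (dual P *> h).
  exact: (transpose_nat (Fm := fun Y Z h => dual B *> dual A *> h) g_nat).
have cap2 : eval B Z \o ((dual B *> eval A (B \ot Z)) \o
    (phi (A \ot (B \ot Z)) \o (dual P *> assoc A B Z))) = eval P Z.
  rewrite /phi transposeE -?compA (comp_chain2 (esym (eval_nat _ _))) -?compA.
  rewrite (comp_chain2 (esym (eval_nat _ _))) -?compA -[RHS]compm1; congr (_ \o _).
  rewrite -!lwD -tensm_id; congr (_ *> _).
  rewrite /g -?compA (comp_chain2 (esym (assocV_lw _ _ _))) -?compA.
  rewrite (comp_chain2 (esym (assocV_lw _ _ _))) -?compA.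
  rewrite !(comp_chain2 (esym (lwD _ _ _))) -?compA.
  rewrite coeval_nat (comp_chain2 (eval_coeval _ _)) comp1m (comp_chain2 (eval_coeval _ _)) comp1m.
  exact: assocK.
have cup2 : (dual B *> dual A *> assoc A B Z) \o (phi (P \ot Z) \o kappa P Z) =
    (dual B *> kappa A (B \ot Z)) \o kappa B Z.
  rewrite /phi (transpose_kappa (sigma := sigma) g_slide) /sigma -?compA.
  rewrite (comp_chain2 (esym (lwD _ _ _))) br_tensl !lwD -?compA.
  rewrite (comp_chain2 (br_tensl _ _ _ _)) -?compA /g (comp_chain2 (twist_tens_br _ _ _)) -?compA.
  rewrite (comp_chain2 (assocVK _ _ _)) comp1m.
  (* The double braiding of A and B moves to the left of the crossings of A and
     B with the dual of B. *)
  rewrite (comp_chain3 (esym (yang_baxter _ _ _ _))) -?compA.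
  rewrite /F (comp_chain3 (esym (yang_baxter A B (dual B) (dual A \ot Z)))) -?compA.
  rewrite (comp_chain2 (esym (whisker_swap (twist A) _))) -?compA
    (comp_chain2 (esym (whisker_swap (twist A) _))) -?compA.
  (* The twist of B, its coevaluation and its crossing with the dual of B make up
     kappa B; then A slides over it, which absorbs one of the two braidings. *)
  have kB : (A *> br B (dual B) (dual A \ot Z)) \o ((A *> (twist B <* (dual B \ot (dual A \ot Z))))
     \o (A *> coeval B (dual A \ot Z))) = A *> kappa B (dual A \ot Z).
    by rewrite kappaE !lwD.
  rewrite (comp_chain3 kB) (comp_chain3 (cup_slide (coev_right B) A (dual A \ot Z))).
  rewrite -/(kappa B _) (comp_chain2 (esym (lwD _ _ _))) (comp_chain2 (esym (lwD _ _ _))) -?compA.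
  (* The other braiding is absorbed when B slides over kappa A. *)
  rewrite -yang_baxter !lwD -?compA (comp_chain2 (kappa_nat _ _)) -?compA -kappaE.
  rewrite -kappa_nat !(comp_chain2 (esym (lwD _ _ _))) -?compA.
  by rewrite (cup_slide (coev_right A) B Z).
rewrite !ptrE -cap2 !lwD -?compA; congr (_ \o (_ \o _)).
rewrite (comp_chain2 (lw_assocVK _ _ _ _)) comp1m (comp_chain2 (esym (phi_nat _ _ _))) -?compA.
by rewrite (comp_chain2 (esym (phi_nat _ _ _))) -?compA cup2.
Qed.

(** Closing a strand on the left does not affect the strands on the right. *)
Lemma ptr_whisker A Y Z (f : hom (A \ot Y) (A \ot Y)) :
  ptr (assoc A Y Z \o ((f <* Z) \o assocV A Y Z)) = ptr f <* Z.
Proof.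
rewrite !ptrE /eval /kappa cap_tens cup_tens !rwD !lwD -?compA; congr (_ \o _).
rewrite (comp_chain2 (lw_assocK _ _ _ _)) comp1m (comp_chain2 (lw_assocK _ _ _ _)) comp1m.
by rewrite (comp_chain2 (assocV_mw _ _ _)) -?compA (comp_chain2 (assocK _ _ _)) comp1m.
Qed.

Lemma ptr_linear A Z : linear (@ptr A Z).
Proof. by move=> a f g; rewrite !ptrE tensm_linr comp_linl comp_linr. Qed.
HB.instance Definition _ A Z :=
  GRing.isLinear.Build K (hom (A \ot Z) (A \ot Z)) (hom Z Z) *:%R (@ptr A Z) (@ptr_linear A Z).

Lemma ptrZ A Z a (f : hom (A \ot Z) (A \ot Z)) : ptr (a *: f) = a *: ptr f.
Proof. exact: (linearZ_LR (@ptr A Z)). Qed.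

Lemma ptr_iso A B Z (F : forall D, hom (D \ot Z) (D \ot Z)) :
    (forall (D D' : C) (u : hom D D'), (u <* Z) \o F D = F D' \o (u <* Z)) ->
  isomorphic A B -> ptr (F A) = ptr (F B).
Proof.
move=> Fnat [u [v [vu uv]]].
have -> : F A = (v <* Z) \o (F B \o (u <* Z)).
  by rewrite -Fnat compA -rwD vu tensm_id comp1m.
by rewrite ptr_cyclic -compA -rwD uv tensm_id compm1.
Qed.

(** Cyclicity applied to the injections and projections of the direct sum. *)
Lemma ptr_sum n (Y : 'I_n -> C) S Z (F : forall D, hom (D \ot Z) (D \ot Z)) :
    (forall (D D' : C) (u : hom D D'), (u <* Z) \o F D = F D' \o (u <* Z)) ->
  is_direct_sum Y S -> ptr (F S) = \sum_a ptr (F (Y a)).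
Proof.
move=> Fnat [inj [prj [prjK _ sumE]]].
have -> : F S = \sum_a ((inj a <* Z) \o ((prj a <* Z) \o F S)).
  rewrite -[LHS]comp1m -[idm _]tensm_id -sumE.
  rewrite -[_ <* Z]/(rwhisk Z (\sum_k (inj k \o prj k))) raddf_sum comp_suml.
  by apply: eq_bigr => a _; rewrite compA -rwD.
rewrite raddf_sum /=; apply: eq_bigr => a _; rewrite ptr_cyclic Fnat -compA -rwD.
by rewrite prjK tensm_id compm1.
Qed.

End RibbonTheory.

(** * Modular categories *)

Section ModularTheory.
Variables (K : closedFieldType) (C : ribbonCat K).
Variables (n : nat) (X : 'I_n.+1 -> C).
Hypothesis hmod : modular X.
Implicit Types A B Y Z : C.

Let hab : abelian C := mod_abelian hmod.
Let I := unit_ob C.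

Lemma dim_hom_reps i j : \dim {: hom (X i) (X j)} = (i == j).
Proof.
have sX := mod_simple hmod; case: eqP => [<- | ij].
  exact: dim_end_simple.
apply: hom_simple0 => // ijX; apply: ij.
have [k [_ kU]] := mod_reps hmod (sX i).
rewrite -(kU i) ?(kU j) //; exact: iso_refl.
Qed.

Lemma decomposition Y : exists N (m : 'I_N -> 'I_n.+1) (Z : 'I_N -> C),
  is_direct_sum Z Y /\ forall a, isomorphic (Z a) (X (m a)).
Proof.
have [N [Z [sZ dsZ]]] := mod_semisimple hmod Y.
have [|m mP] := @fin_all_exists 'I_N _ (fun a i => isomorphic (Z a) (X i)).
  by move=> a; have [i [iP _]] := mod_reps hmod (sZ a); exists i.
by exists N, m, Z.
Qed.

Definition mult Y k := \dim {: hom Y (X k)}.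

Lemma mult_sum N (m : 'I_N -> 'I_n.+1) (Z : 'I_N -> C) Y k :
    is_direct_sum Z Y -> (forall a, isomorphic (Z a) (X (m a))) ->
  mult Y k = (\sum_a (m a == k))%N.
Proof.
move=> dsZ ZX; rewrite /mult (dim_hom_suml _ dsZ); apply: eq_bigr => a _.
by rewrite (dim_hom_isol _ (ZX a)) dim_hom_reps.
Qed.

Lemma mult_sym Y k : \dim {: hom (X k) Y} = mult Y k.
Proof.
have [N [m [Z [dsZ ZX]]]] := decomposition Y.
rewrite (mult_sum _ dsZ ZX) (dim_hom_sumr _ dsZ); apply: eq_bigr => a _.
by rewrite (dim_hom_isor _ (ZX a)) dim_hom_reps eq_sym.
Qed.

Lemma sum_by_mult (V : nmodType) Y N (m : 'I_N -> 'I_n.+1) (Z : 'I_N -> C)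
    (f : 'I_n.+1 -> V) :
    is_direct_sum Z Y -> (forall a, isomorphic (Z a) (X (m a))) ->
  \sum_a f (m a) = \sum_k f k *+ mult Y k.
Proof.
move=> dsZ ZX; under [RHS]eq_bigr => k _ do rewrite (mult_sum k dsZ ZX) -sumrMnr.
rewrite exchange_big; apply: eq_bigr => a _ /=.
rewrite (bigD1 (m a)) //= eqxx mulr1n big1 ?addr0 // => k.
by rewrite eq_sym => /negPf ->.
Qed.

(** By semisimplicity, the multiplicities leave room for one summand only. *)
Lemma iso_of_mult Y k : (forall l, mult Y l = (l == k)) -> isomorphic Y (X k).
Proof.
move=> multY; have [N [m [Z [dsZ ZX]]]] := decomposition Y.
have mk a : m a = k.
  apply/eqP; rewrite eq_sym; apply/negPn/negP => km.
  have := multY (m a); rewrite (mult_sum _ dsZ ZX) (bigD1 a) //= eqxx.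
  by rewrite eq_sym (negPf km).
have N1 : N = 1%N.
  have := multY k; rewrite (mult_sum _ dsZ ZX) eqxx.
  under eq_bigr => a _ do rewrite mk eqxx.
  by rewrite sum1_card card_ord.
subst N; have [inj [prj [prjK _ sumE]]] := dsZ.
apply: iso_trans (_ : isomorphic Y (Z ord0)) _; last by rewrite -(mk ord0).
exists (prj ord0), (inj ord0); split; last exact: prjK.
by rewrite big_ord1 in sumE.
Qed.

Lemma ptr_mult Y Z (F : forall D : C, hom (D \ot Z) (D \ot Z)) :
    (forall (D D' : C) (u : hom D D'), (u <* Z) \o F D = F D' \o (u <* Z)) ->
  ptr (F Y) = \sum_k ptr (F (X k)) *+ mult Y k.
Proof.
move=> Fnat; have [N [m [W [dsW WX]]]] := decomposition Y.
rewrite (ptr_sum Fnat dsW) -(sum_by_mult (fun k => ptr (F (X k))) dsW WX).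
by apply: eq_bigr => a _; apply: ptr_iso.
Qed.

(** Here the braiding of the quantum trace is absorbed in coev_right. *)
Lemma qtraceE Y (f : hom Y Y) : ptr (f <* I) = qtrace f *: idm I.
Proof.
rewrite /qtrace; set x := (x in scalar_of x); rewrite -(scalar_ofE hab x (mod_unit hmod)).
transitivity (lunit I \o ((x <* I) \o lunitV I)); last first.
  rewrite (scalar_ofE hab x (mod_unit hmod)) rwZ tensm_id compZl compZr comp1m.
  by rewrite lunitVK.
rewrite ptrE /eval /kappa capE cupE -?compA.
rewrite (comp_chain2 (assocV_mw _ _ _)) -?compA (comp_chain2 (assocK _ _ _)) comp1m.
rewrite (comp_chain2 (esym (rwD _ _ _))) (comp_chain2 (esym (rwD _ _ _))).
congr (_ \o ((_ <* _) \o _)).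
rewrite /x /coev_right -?compA (comp_chain2 (esym (braid_nat _ _))) -?compA.
by rewrite (comp_chain2 (esym (rwD _ _ _))) -twist_nat.
Qed.

Definition theta_rep i : K := theta (X i).
Definition qdim_rep i : K := qdim (X i).

Lemma theta_repE i : twist (X i) = theta_rep i *: idm (X i).
Proof. exact (scalar_ofE hab (twist (X i)) (mod_simple hmod i)). Qed.

Lemma theta_rep_neq0 i : theta_rep i != 0.
Proof.
apply/eqP => t0; have [g [gt _]] := twist_iso (X i).
by case: (mod_simple hmod i) => + _; apply; rewrite -gt theta_repE t0 scale0r comp0r.
Qed.

Lemma scale_idm_inj Y (a b : K) : idm Y <> 0 -> a *: idm Y = b *: idm Y -> a = b.
Proof.
by move=> Y0 ab; rewrite -(scalar_ofZ a Y0) ab scalar_ofZ.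
Qed.

Lemma ptr_twist Y :
  ptr (twist Y <* I) = (\sum_k (mult Y k)%:R * qdim_rep k * theta_rep k) *: idm I.
Proof.
rewrite (@ptr_mult Y I (fun D => twist D <* I)); last first.
  by move=> D D' u; rewrite -!rwD twist_nat.
rewrite scaler_suml; apply: eq_bigr => k _.
rewrite theta_repE rwZ ptrZ qtraceE scalerA -scaler_nat scalerA -mulrA; congr ((_ * _) *: _).
by rewrite mulrC.
Qed.

(** The scalar by which a closed strand A encircling the simple object X_j acts
    on it. *)
Definition chi A j : K := scalar_of (ptr (braid (X j) A \o braid A (X j))).

Lemma chiE A j : ptr (braid (X j) A \o braid A (X j)) = chi A j *: idm (X j).
Proof. exact (scalar_ofE hab (ptr _) (mod_simple hmod j)). Qed.

Lemma ptr_br A j Z : ptr (br (X j) A Z \o br A (X j) Z) = chi A j *: idm (X j \ot Z).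
Proof.
rewrite -tensm_id -rwZ -chiE -ptr_whisker !brE rwD -?compA.
by rewrite (comp_chain2 (assocK _ _ _)) comp1m.
Qed.

Lemma idm_unit_tens j : idm (X j \ot I) <> 0.
Proof.
case: (mod_simple hmod j) => Xj0 _ E; apply: Xj0.
have [g [gr rg]] := runit_iso (X j).
by rewrite -rg -[g]comp1m -[unit_ob C]/I E comp0l comp0r.
Qed.

(** By the hexagons, A (x) B encircles X_j when B does and then A does; the inner
    closed strand A contributes a scalar, which can be taken out. *)
Lemma chi_tens A B j : chi (A \ot B) j = chi A j * chi B j.
Proof.
apply: (scale_idm_inj (@idm_unit_tens j)); rewrite -ptr_br.
set Y := X j.
have E1 : br Y (A \ot B) I = assocV A B (Y \ot I) \o
    ((A *> br Y B I) \o (br Y A (B \ot I) \o (Y *> assoc A B I))).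
  by rewrite -br_tensr (comp_chain2 (assocK _ _ _)) comp1m.
have E2 : br (A \ot B) Y I = (Y *> assocV A B I) \o
    (br A Y (B \ot I) \o ((A *> br B Y I) \o assoc A B (Y \ot I))).
  by rewrite -br_tensl (comp_chain2 (lw_assocK _ _ _ _)) comp1m.
rewrite E1 E2 -?compA (comp_chain2 (lw_assocVK _ _ _ _)) comp1m.
set f := _ \o _; have -> : f = assocV A B (Y \ot I) \o (((A *> br Y B I) \o
    ((br Y A (B \ot I) \o br A Y (B \ot I)) \o (A *> br B Y I))) \o assoc A B (Y \ot I)).
  by rewrite /f -?compA.
rewrite ptr_tens ptr_nat ptr_br compZl compZr comp1m ptrZ ptr_br.
by rewrite scalerA.
Qed.

Lemma chi_mult A j : chi A j = \sum_k chi (X k) j *+ mult A k.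
Proof.
have Xj0 : idm (X j) <> 0 by case: (mod_simple hmod j).
apply: (scale_idm_inj Xj0).
rewrite -chiE (@ptr_mult A (X j) (fun D => braid (X j) D \o braid D (X j))).
  by rewrite scaler_suml; apply: eq_bigr => k _; rewrite chiE scalerMnl.
move=> D D' u; rewrite compA -braid_nat -?compA; congr (_ \o _).
by rewrite braid_nat.
Qed.

(** The Hopf link pairing of X_i and X_j. *)
Definition hopf i j : K :=
  (theta_rep i * theta_rep j)^-1 *
    \sum_k (fusion_coef (X i) (X j) (X k))%:R * qdim_rep k * theta_rep k.

(** The twist of X_i (x) X_j is the double braiding times the twists of the
    factors; closing X_i gives chi, and closing X_j then gives the dimension. *)
Lemma hopfE i j : hopf i j = chi (X i) j * qdim_rep j.
Proof.
have I0 : idm I <> 0 by case: (mod_unit hmod).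
apply: (scale_idm_inj I0).
have -> : hopf i j *: idm I =
    (theta_rep i * theta_rep j)^-1 *: ptr (twist (X i \ot X j) <* I).
  by rewrite ptr_twist scalerA.
have -> : twist (X i \ot X j) <* I = assocV (X i) (X j) I \o
    (((theta_rep i * theta_rep j) *: (br (X j) (X i) I \o br (X i) (X j) I)) \o
      assoc (X i) (X j) I).
  rewrite -[LHS]compm1 -(assocK (X i) (X j) I) compA twist_tens_br !theta_repE !rwZ !lwZ.
  rewrite !tensm_id -?compA; congr (_ \o _).
  by rewrite !(compZl, compZr, comp1m, compm1) !scalerA mulrC -?compA.
rewrite ptr_tens ptrZ ptr_br !ptrZ -tensm_id qtraceE !scalerA; congr (_ *: _).
by rewrite mulKf ?mulf_neq0 ?theta_rep_neq0.
Qed.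

Local Notation N i j k := (fusion_coef (X i) (X j) (X k)).

Lemma hopf_mul i k j : hopf i j * hopf k j = qdim_rep j * \sum_l (N i k l)%:R * hopf l j.
Proof.
rewrite !hopfE mulrACA -chi_tens chi_mult mulrA mulrC; congr (_ * _).
rewrite mulr_suml; apply: eq_bigr => l _; rewrite hopfE mulrA; congr (_ * _).
by rewrite mulr_natl.
Qed.

Lemma fusion_comm i k l : N i k l = N k i l.
Proof. by apply: dim_hom_isol; exists (braid (X i) (X k)); apply: braid_iso. Qed.

Lemma fusion_unit k l : N ord0 k l = (k == l).
Proof. by rewrite -dim_hom_reps; apply: dim_hom_isol; rewrite (mod_X0 hmod); apply: iso_lunit. Qed.

Lemma dual_fusion i k l : \dim {: hom (dual (X i) \ot X k) (X l)} =
  (\sum_m mult (dual (X i)) m * N m k l)%N.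
Proof.
have [r [m [Z [dsZ ZX]]]] := decomposition (dual (X i)).
rewrite (dim_hom_suml _ (direct_sum_tensr (X k) dsZ)).
transitivity (\sum_a N (m a) k l)%N.
  apply: eq_bigr => a _; apply: dim_hom_isol.
  by apply: iso_tens; [exact: ZX | exact: iso_refl].
rewrite [LHS](sum_by_mult (fun m => N m k l) dsZ ZX).
by apply: eq_bigr => q _; rewrite -[LHS]mulr_natl natn.
Qed.

(** Frobenius reciprocity: the adjunction of the functors dual (X i) (x) - and
    X i (x) -, together with semisimplicity. *)
Lemma fusion_adj i k l : (\sum_m mult (dual (X i)) m * N m k l)%N = N i l k.
Proof. by rewrite -dual_fusion (dim_hom_adj (left_dual (X i))) mult_sym. Qed.

(** Decomposing the duals into simple objects writes the S-matrix as a product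
    with h as right factor. *)
Lemma hopf_unit : \matrix_(i, j) hopf i j \in unitmx.
Proof.
pose T := \matrix_(i, m) ((theta_rep i)^-1 * (mult (dual (X i)) m)%:R * theta_rep m).
suff E : Smatrix X = T *m \matrix_(i, j) hopf i j.
  by have := mod_S hmod; rewrite E unitmx_mul => /andP[].
apply/matrixP => i j; rewrite !mxE.
transitivity ((theta_rep i * theta_rep j)^-1 * \sum_k \sum_m
    (mult (dual (X i)) m)%:R * ((N m j k)%:R * qdim_rep k * theta_rep k)).
  congr (_ * _); apply: eq_bigr => k _; rewrite /fusion_coef dual_fusion natr_sum.
  by rewrite !mulr_suml; apply: eq_bigr => m _; rewrite natrM !mulrA.
rewrite exchange_big mulr_sumr; apply: eq_bigr => m _; rewrite !mxE /hopf -mulr_sumr.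
by rewrite !invfM !mulrA; congr (_ * _); rewrite mulfK ?theta_rep_neq0 // mulrAC.
Qed.

(** From the fusion coefficients alone, h_0j is d_j divided by the twist of the
    unit; as it is also idempotent up to the factor d_j, it equals d_j. *)
Lemma hopf0 j : (forall i, qdim_rep i != 0) -> hopf ord0 j = qdim_rep j.
Proof.
move=> d0; have h0 : hopf ord0 j != 0.
  rewrite /hopf (bigD1 j) //= big1 ?addr0; last first.
    by move=> k kj; rewrite fusion_unit eq_sym (negPf kj) !mul0r.
  by rewrite fusion_unit eqxx mul1r !mulf_neq0 ?invr_neq0 ?mulf_neq0 ?theta_rep_neq0.
apply: (mulfI h0); rewrite hopf_mul mulrC; congr (_ * _).
rewrite (bigD1 ord0) //= big1 ?addr0; last first.
  by move=> k k0; rewrite fusion_unit eq_sym (negPf k0) mul0r.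
by rewrite fusion_unit eqxx mul1r.
Qed.

Lemma hopf_sym i j : hopf i j = hopf j i.
Proof.
rewrite /hopf [theta_rep i * _]mulrC; congr (_ * _); apply: eq_bigr => k _.
by rewrite fusion_comm.
Qed.

Lemma invertible_of_fusion i j : (forall k, N i j k = (k == ord0)) -> invertible (X i).
Proof.
move=> Nij; exists (X j); rewrite -(mod_X0 hmod).
split; apply: iso_of_mult => k; first exact: Nij.
by rewrite -[mult _ _]/(N j i k) fusion_comm.
Qed.

End ModularTheory.

Lemma invertible_iso (K : fieldType) (C : monoidalCat K) (X Y : C) :
  isomorphic X Y -> invertible Y -> invertible X.
Proof.
move=> XY [Z [YZ ZY]]; exists Z.
split; [apply: iso_trans YZ | apply: iso_trans ZY]; apply: iso_tens => //; exact: iso_refl.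
Qed.

(** * Arithmetic of the dimensions *)

(** A root of the characteristic polynomial, which is monic with integer
    coefficients, is an algebraic integer. *)
Lemma int_of_rat_eigenvalue (K : numFieldType) n (B : 'I_n -> 'I_n -> int)
    (v : 'I_n -> K) (q : rat) i0 :
    v i0 != 0 -> (forall k, \sum_l (B k l)%:~R * v l = ratr q * v k) ->
  exists z : int, q = z%:~R.
Proof.
move=> v0 Bv.
pose Bz : 'M[int]_n := \matrix_(l, k) B k l.
pose p := char_poly Bz.
have rootK : root (map_poly (intr : int -> K) p) (ratr q).
  rewrite /p map_char_poly -eigenvalue_root_char.
  apply/eigenvalueP; exists (\row_l v l).
    by apply/rowP => k; rewrite !mxE -Bv; apply: eq_bigr => l _; rewrite !mxE mulrC.
  by apply/eqP => /rowP /(_ i0); rewrite !mxE => /eqP; rewrite (negPf v0).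
have rootQ : root (map_poly (intr : int -> rat) p) q.
  rewrite -(fmorph_root (ratr : {rmorphism rat -> K})) -map_poly_comp.
  by rewrite (eq_map_poly (g := intr)) // => z /=; rewrite ratr_int.
have rootC : root (map_poly (intr : int -> algC) p) (ratr q).
  have := rootQ; rewrite -(fmorph_root (ratr : {rmorphism rat -> algC})) -map_poly_comp.
  by rewrite (eq_map_poly (g := intr)) // => z /=; rewrite ratr_int.
have qA : (ratr q : algC) \in Aint.
  apply: root_monic_Aint rootC _ _; first by rewrite monic_map ?char_poly_monic.
  by apply/polyOverP => i; rewrite coef_map /= intr_int.
have /intrP [z zq] := Cint_rat_Aint (Crat_rat q) qA.
exists z; apply: (fmorph_inj (ratr : {rmorphism rat -> algC})).
by rewrite /= ratr_int -zq.
Qed.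

(** An odd square is 1 modulo 8, so the quotient of S by it is congruent to S; it
    is then at least 5 if S is 5 modulo 8, and at least 8 if 8 divides S.  The
    square of twice an odd number is 4 modulo 16, so the quotient is even if 8
    divides S.  The square of a multiple of 4 is divisible by 16, hence so is S. *)
Lemma square_dvd_cases (a x S : nat) : S = (x * a ^ 2)%N -> (0 < S)%N ->
  [\/ exists k, [/\ a ^ 2 = 8 * k + 1, (forall u, S = 8 * u + 5 -> 5 * a ^ 2 <= S)
        & (forall u, S = 8 * u -> 8 * a ^ 2 <= S)]%N,
      exists k v, [/\ a ^ 2 = 8 * k + 4, S = 4 * v & (forall u, S = 8 * u -> 2 * a ^ 2 <= S)]%N
    | exists k v, [/\ a ^ 2 = 8 * k & S = 16 * v]%N].
Proof.
move=> SE S0.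
have bound c : (c <= x)%N -> (c * a ^ 2 <= S)%N by move=> cx; rewrite SE leq_mul2r cx orbT.
have x0 : (0 < x)%N by move: S0; rewrite SE; case: (x).
have [[k ak] | [[k ak] | [k ak]]] : (exists k, a = 2 * k + 1)%N \/ (exists k, a = 4 * k + 2)%N
    \/ (exists k, a = 4 * k)%N.
  have : (a %% 4 < 4)%N by rewrite ltn_mod.
  have := divn_eq a 4; case: (a %% 4)%N => [|[|[|[|//]]]] aE _.
  - by right; right; exists (a %/ 4)%N; lia.
  - by left; exists (2 * (a %/ 4))%N; lia.
  - by right; left; exists (a %/ 4)%N; lia.
  by left; exists (2 * (a %/ 4) + 1)%N; lia.
- have [t tE] : exists t, (a ^ 2 = 8 * t + 1)%N.
    have [u uE] : exists u, (k * (k + 1) = 2 * u)%N.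
      exists (k * (k + 1))./2; have := odd_double_half (k * (k + 1)).
      by rewrite oddM oddD /=; case: (odd k) => /=; lia.
    by exists u; rewrite ak; nia.
  have SE' : (S = 8 * (x * t) + x)%N by rewrite SE tE; lia.
  constructor 1; exists t; split=> // u uE; apply: bound; move: SE'; rewrite uE.
    by move: (x * t)%N => y; lia.
  by move: (x * t)%N => y; lia.
- have aE : (a ^ 2 = 16 * (k * k + k) + 4)%N by rewrite ak; nia.
  have SE' : (S = 16 * (x * (k * k + k)) + 4 * x)%N by rewrite SE aE; lia.
  constructor 2; exists (2 * (k * k + k))%N, (4 * (x * (k * k + k)) + x)%N.
  split; [lia | lia | move=> u uE; apply: bound; move: SE'; rewrite uE].
  by move: (x * _)%N => y; lia.
have aE : (a ^ 2 = 16 * (k * k))%N by rewrite ak; nia.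
constructor 3; exists (2 * (k * k))%N, (x * (k * k))%N; rewrite SE aE; split; lia.
Qed.

(** Modulo 8, either the five squares are all odd, and then each quotient is at
    least 5; or exactly one is even, and then the quotients are at least 8, 8, 8,
    8 and 2.  The reciprocals of the quotients add up to 1, and so do those of
    the bounds; hence the bounds are attained. *)
Lemma five_squares_nat b c d e (S := (1 + (b ^ 2 + (c ^ 2 + (d ^ 2 + e ^ 2))))%N) :
    (exists x, S = x * b ^ 2)%N -> (exists x, S = x * c ^ 2)%N ->
    (exists x, S = x * d ^ 2)%N -> (exists x, S = x * e ^ 2)%N ->
  [/\ b = 1, c = 1, d = 1 & e = 1]%N \/
  [\/ [/\ b = 2, c = 1, d = 1 & e = 1]%N,
      [/\ b = 1, c = 2, d = 1 & e = 1]%N, [/\ b = 1, c = 1, d = 2 & e = 1]%N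
    | [/\ b = 1, c = 1, d = 1 & e = 2]%N].
Proof.
have sq1 u : (u ^ 2 = 1)%N -> u = 1%N by nia.
have sq2 u : (u ^ 2 = 4)%N -> u = 2%N by nia.
move=> [xb Sb] [xc Sc] [xd Sd] [xe Se].
have S0 : (0 < S)%N by [].
have := square_dvd_cases Sb S0; have := square_dvd_cases Sc S0.
have := square_dvd_cases Sd S0; have := square_dvd_cases Se S0.
have : S = (1 + (b ^ 2 + (c ^ 2 + (d ^ 2 + e ^ 2))))%N by [].
move: (sq1 b) (sq1 c) (sq1 d) (sq1 e) (sq2 b) (sq2 c) (sq2 d) (sq2 e).
clear; move: (b ^ 2)%N (c ^ 2)%N (d ^ 2)%N (e ^ 2)%N S => B C D E S.
move=> b1 c1 d1 e1 b2 c2 d2 e2 SE.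
case=> [[k1 [E1 G1 F1]]|[k1 [v1 [E1 G1 F1]]]|[k1 [v1 [E1 G1]]]];
case=> [[k2 [E2 G2 F2]]|[k2 [v2 [E2 G2 F2]]]|[k2 [v2 [E2 G2]]]];
case=> [[k3 [E3 G3 F3]]|[k3 [v3 [E3 G3 F3]]]|[k3 [v3 [E3 G3]]]];
case=> [[k4 [E4 G4 F4]]|[k4 [v4 [E4 G4 F4]]]|[k4 [v4 [E4 G4]]]];
try (exfalso; clear -SE E1 E2 E3 E4 G1 G2 G3 G4; lia).
(* The four bounds add up to 5 * (S - 1) <= 4 * S, so S = 5. *)
- have SE5 : (S = 8 * (k1 + k2 + k3 + k4) + 5)%N by clear -SE E1 E2 E3 E4; lia.
  move: (G1 _ SE5) (G2 _ SE5) (G3 _ SE5) (G4 _ SE5) => {F1 F2 F3 F4} {}G1 {}G2 {}G3 {}G4.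
  by left; split; [apply: b1 | apply: c1 | apply: d1 | apply: e1];
    clear -SE G1 G2 G3 G4 E1 E2 E3 E4; lia.
(* Each remaining goal has one even square; three bounds S / 8 and one bound
   S / 2 give S - 1 <= 7 * S / 8, so S = 8. *)
all: have SE8 : (S = 8 * (k1 + k2 + k3 + k4 + 1))%N by clear -SE E1 E2 E3 E4; lia.
all: move: (F1 _ SE8) (F2 _ SE8) (F3 _ SE8) (F4 _ SE8) => {}F1 {}F2 {}F3 {}F4.
all: right.
all: [> constructor 1 | constructor 2 | constructor 3 | constructor 4].
all: split; first [apply: b1 | apply: b2 | apply: c1 | apply: c2 | apply: d1 | apply: d2
  | apply: e1 | apply: e2]; clear -SE F1 F2 F3 F4 E1 E2 E3 E4; lia.
Qed.

Lemma five_squares (a : 'I_5 -> nat) : a ord0 = 1%N ->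
    (forall j, exists x, (\sum_i a i ^ 2 = x * a j ^ 2)%N) ->
  (forall i, a i = 1%N) \/
  [/\ (\sum_i a i ^ 2 = 8)%N, (exists j, a j = 2%N) & (\sum_i (a i == 1%N) = 4)%N].
Proof.
move=> a0 aS.
have /= [+ [+ [+ +]]] := (aS (lift ord0 ord0), (aS (lift ord0 (lift ord0 ord0)),
  (aS (lift ord0 (lift ord0 (lift ord0 ord0))),
   aS (lift ord0 (lift ord0 (lift ord0 (lift ord0 ord0))))))).
rewrite !big_ord_recl !big_ord0 a0 exp1n !addn0 => S1 S2 S3 S4.
have [[a1 a2 a3 a4]|H] := five_squares_nat S1 S2 S3 S4.
  left=> -[[|[|[|[|[|//]]]]] lt5].
  - by rewrite -[RHS]a0; congr a; apply: val_inj.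
  - by rewrite -[RHS]a1; congr a; apply: val_inj.
  - by rewrite -[RHS]a2; congr a; apply: val_inj.
  - by rewrite -[RHS]a3; congr a; apply: val_inj.
  by rewrite -[RHS]a4; congr a; apply: val_inj.
right; case: H => -[b1 b2 b3 b4]; rewrite b1 b2 b3 b4; split=> //;
  [exists (lift ord0 ord0) | exists (lift ord0 (lift ord0 ord0))
  | exists (lift ord0 (lift ord0 (lift ord0 ord0)))
  | exists (lift ord0 (lift ord0 (lift ord0 (lift ord0 ord0))))] => //.
Qed.

(** What the sequel uses of a modular category: N stands for the fusion
    coefficients, M i m for the multiplicity of X_m in the dual of X_i, h for the
    Hopf link pairing and d for the dimensions.  The
    normalised dimensions are delta_i = d_i / d_0. *)
Section FusionData.
Variables (K : numClosedFieldType) (n : nat).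
Local Notation I := 'I_n.+1.
Variables (N : I -> I -> I -> nat) (M : I -> I -> nat).
Variables (h : I -> I -> K) (d : I -> K).
Hypothesis NC : forall i k l, N i k l = N k i l.
Hypothesis N0 : forall k l, N ord0 k l = (k == l).
Hypothesis NM : forall i k l, (\sum_m M i m * N m k l)%N = N i l k.
Hypothesis hM : forall i k j, h i j * h k j = d j * \sum_l (N i k l)%:R * h l j.
Hypothesis hS : forall i j, h i j = h j i.
Hypothesis h0 : forall j, h ord0 j = d j.
Hypothesis hU : \matrix_(i, j) h i j \in unitmx.
Hypothesis d_gt0 : forall i, 0 < d i.
Hypothesis d_int : forall i, exists m : int, d i = m%:~R.

Lemma N0r k l : N k ord0 l = (k == l). Proof. by rewrite NC N0. Qed.

Lemma d_neq0 i : d i != 0. Proof. by rewrite gt_eqF. Qed.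

(** The matrices M and (N i k 0) are inverse to each other and have entries in
    the natural numbers, so they are permutation matrices. *)
Lemma dual_perm : exists s : I -> I, [/\ involutive s,
  forall i k l, N (s i) k l = N i l k & forall i k, N i k ord0 = (k == s i)].
Proof.
have MC i k : (\sum_m M i m * N m k ord0)%N = (i == k) by rewrite NM N0r.
have [s sP] : exists s : I -> I, forall i, M i (s i) != 0%N /\ N (s i) i ord0 != 0%N.
  apply: (@fin_all_exists _ _ (fun i m => M i m != 0%N /\ N m i ord0 != 0%N)) => i.
  have : (\sum_m M i m * N m i ord0)%N != 0%N by rewrite MC eqxx.
  case: (pickP (fun m => (M i m * N m i ord0)%N != 0%N)) => [m|m0].
    by rewrite muln_eq0 negb_or => /andP[Mm Nm] _; exists m.
  by rewrite big1 // => m _; apply/eqP/negbFE/m0.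
have Cs i k : N (s i) k ord0 = (i == k).
  have [Mi Ni] := sP i.
  have : (M i (s i) * N (s i) k ord0 <= (i == k))%N.
    by rewrite -MC (bigD1 (s i)) //= leq_addr.
  case: eqP => [<- | _]; last by rewrite leqn0 muln_eq0 (negPf Mi) => /eqP.
  by move: Mi Ni; case: (M i (s i)) (N (s i) i ord0) => [|a] [|[|b]].
have s_sym i j : (s i == j) = (i == s j).
  have := Cs i (s j); rewrite NC Cs eq_sym.
  by case: (s i == j); case: (i == s j).
have sK : involutive s by move=> i; apply/eqP; rewrite s_sym.
exists s; split=> // [i k l | i k]; last by rewrite -{1}(sK i) Cs eq_sym.
rewrite -[RHS]NM (bigD1 (s i)) //= big1 => [|m ms].
  have := MC i i; rewrite eqxx (bigD1 (s i)) //= Cs eqxx muln1 big1 ?addn0.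
    by move=> ->; rewrite mul1n.
  by move=> m ms; rewrite -{2}(sK m) Cs s_sym (negPf ms) muln0.
have := MC i (s m); rewrite -(s_sym) eq_sym (negPf ms).
rewrite (bigD1 m) //= => /eqP; rewrite addn_eq0 => /andP[+ _].
by rewrite -{2}(sK m) Cs eqxx muln1 => /eqP ->.
Qed.

(** The j-th character of the fusion ring, the one called chi_j above; for j = 0
    it is the normalised dimension. *)
Definition fchar j i := h i j / d j.
Local Notation delta := (fchar ord0).

Lemma fchar_mul j i k : fchar j i * fchar j k = \sum_l (N i k l)%:R * fchar j l.
Proof.
rewrite /fchar mulrACA hM mulrA (mulrAC (d j)) divff ?d_neq0 // mul1r mulr_suml.
by apply: eq_bigr => l _; rewrite mulrA.
Qed.

Lemma fchar_unit j : fchar j ord0 = 1.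
Proof. by rewrite /fchar h0 divff ?d_neq0. Qed.

Lemma deltaE i : delta i = d i / d ord0.
Proof. by rewrite /fchar hS h0. Qed.

Lemma delta_gt0 i : 0 < delta i.
Proof. by rewrite deltaE divr_gt0. Qed.

Lemma hE i j : h i j = fchar j i * d j.
Proof. by rewrite /fchar divfK ?d_neq0. Qed.

Lemma fchar_inj i k : (forall j, fchar j i = fchar j k) -> i = k.
Proof.
move=> ik; apply/eqP; apply/negPn/negP => nik.
have := mulmxV hU => /matrixP E.
have := E i i; have := E k i; rewrite !mxE eqxx eq_sym (negPf nik).
under eq_bigr => j _ do rewrite mxE hE -ik -hE.
move=> E0; under eq_bigr => j _ do rewrite mxE.
by rewrite E0 => /eqP; rewrite eq_sym oner_eq0.
Qed.

Section Dual.
Variable s : I -> I.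
Hypothesis sK : involutive s.
Hypothesis Ns : forall i k l, N (s i) k l = N i l k.
Hypothesis Nd : forall i k, N i k ord0 = (k == s i).

Lemma sum_dual (V : nmodType) (F : I -> V) : \sum_i F (s i) = \sum_i F i.
Proof. by rewrite [RHS](reindex_inj (inv_inj sK)). Qed.

Lemma N_rot k i m : N k i m = N k (s m) (s i).
Proof. by rewrite [LHS]NC -[LHS]Ns [RHS]NC [RHS]Ns [RHS]NC. Qed.

(** Both delta (s i) and delta i are the quotient of v^T (N i) v by v^T v, for v
    the vector of the dimensions, since N (s i) is the transpose of N i. *)
Lemma delta_dual i : delta (s i) = delta i.
Proof.
have S0 : \sum_k delta k * delta k != 0.
  rewrite gt_eqF // (bigD1 ord0) //=; apply: ltr_pwDl; first by rewrite mulr_gt0 ?delta_gt0.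
  by apply: sumr_ge0 => k _; apply: mulr_ge0; apply/ltW/delta_gt0.
apply: (mulIf S0); rewrite !mulr_sumr.
transitivity (\sum_k \sum_l delta k * (N (s i) k l)%:R * delta l).
  by apply: eq_bigr => k _; rewrite mulrCA mulrA -mulrA fchar_mul mulr_sumr;
     apply: eq_bigr => l _; rewrite mulrA.
rewrite exchange_big; apply: eq_bigr => l _ /=.
rewrite mulrCA mulrA -mulrA fchar_mul mulr_sumr; apply: eq_bigr => k _.
by rewrite Ns -mulrA mulrC -mulrA mulrCA.
Qed.

Definition gdim := \sum_i d i ^+ 2.

Lemma gdim_gt0 : 0 < gdim.
Proof.
rewrite /gdim (bigD1 ord0) //=; apply: ltr_pwDl; first by rewrite exprn_gt0.
by apply: sumr_ge0 => i _; rewrite exprn_ge0 // ltW.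
Qed.

(** The usual argument for distinct characters: multiplying the sum S by X_i
    multiplies it both by delta(i) and by chi_k(i).  If S is not zero, then
    chi_k = delta, and two columns of h are proportional. *)
Lemma delta_orth k : k != ord0 -> \sum_j delta j * fchar k j = 0.
Proof.
move=> k0; set S := \sum_j _.
have E i : delta i * S = fchar k i * S.
  have -> : S = \sum_j delta (s j) * fchar k j by apply: eq_bigr => j _; rewrite delta_dual.
  rewrite mulr_sumr [RHS]mulr_sumr.
  transitivity (\sum_j \sum_m (N i (s j) (s m))%:R * delta (s m) * fchar k j).
    apply: eq_bigr => j _; rewrite mulrA fchar_mul mulr_suml.
    by rewrite -[LHS](sum_dual (fun m => (N i (s j) m)%:R * delta m * fchar k j)).
  rewrite exchange_big; apply: eq_bigr => m _ /=.
  rewrite mulrCA fchar_mul mulr_sumr; apply: eq_bigr => j _.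
  by rewrite -N_rot [RHS]mulrCA mulrA.
case: (eqVneq S 0) => // S0; exfalso.
have col i : h i k = d k / d ord0 * h i ord0.
  by rewrite !hE -(mulIf S0 (E i)) mulrC -mulrA; congr (_ * _); rewrite mulrC divfK ?d_neq0.
have /matrixP EV := mulVmx hU; set H := matrix_of_fun _ _ in EV.
have := EV k k; have := EV k ord0; rewrite !mxE eqxx (negPf k0) => Ek0.
rewrite (eq_bigr (fun j => d k / d ord0 * (invmx H k j * H j ord0))); last first.
  by move=> j _; rewrite {2}/H mxE col mulrCA; congr (_ * (_ * _)); rewrite mxE.
by rewrite -mulr_sumr Ek0 mulr0 => /eqP; rewrite eq_sym oner_eq0.
Qed.

Lemma sum_d_h k : \sum_j d j * h j k = (k == ord0)%:R * gdim.
Proof.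
case: eqVneq => [-> | k0].
  by rewrite mul1r; apply: eq_bigr => j _; rewrite hS h0 expr2.
rewrite mul0r; transitivity (d ord0 * d k * \sum_j delta j * fchar k j); last first.
  by rewrite delta_orth // mulr0.
rewrite mulr_sumr; apply: eq_bigr => j _.
rewrite deltaE hE; field; exact: d_neq0.
Qed.

(** The square of h is a multiple of the permutation s: by the product formula
    for the rows of h, this follows from the orthogonality of the characters to
    the dimension. *)
Lemma sum_h_h i k : \sum_j h i j * h k j = (k == s i)%:R * gdim.
Proof.
under eq_bigr => j _ do rewrite hM mulr_sumr.
rewrite exchange_big /=.
rewrite (eq_bigr (fun l => (N i k l)%:R * ((l == ord0)%:R * gdim))); last first.
  move=> l _; rewrite -sum_d_h mulr_sumr; apply: eq_bigr => j _.
  by rewrite mulrCA [h j l]hS.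
rewrite (bigD1 ord0) //= big1 ?addr0; last by move=> l /negPf ->; rewrite mul0r mulr0.
by rewrite mul1r Nd.
Qed.

(** If s also denotes the permutation matrix, h h = D s says that h s / D is a
    right inverse of h; it is then a left inverse. *)
Lemma sum_h_dual_h j : \sum_l h (s l) j * h l j = gdim.
Proof.
have g0 : gdim != 0 by rewrite gt_eqF ?gdim_gt0.
pose H := \matrix_(i, j) h i j.
pose HP := \matrix_(i, j) (h i (s j) / gdim).
have HHP : H *m HP = 1%:M.
  apply/matrixP => i k; rewrite !mxE.
  under eq_bigr => l _ do rewrite !mxE mulrA [h l _]hS.
  rewrite -mulr_suml sum_h_h (inj_eq (inv_inj sK)) mulfK //.
  by rewrite eq_sym.
have /matrixP /(_ j j) := mulmx1C HHP; rewrite !mxE eqxx => E.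
transitivity (1 * gdim); last exact: mul1r.
rewrite -[1]E mulr_suml; apply: eq_bigr => l _; rewrite !mxE.
by rewrite mulrAC divfK // hS.
Qed.

(** The value of the j-th character at the sum of the products X_l X_(s l). *)
Lemma sum_fchar_dual j : \sum_l fchar j l * fchar j (s l) = gdim / d j ^+ 2.
Proof.
rewrite -(sum_h_dual_h j) mulr_suml; apply: eq_bigr => l _.
by rewrite /fchar mulrACA -invfM -expr2 mulrC [h l j * _]mulrC mulrC.
Qed.

(** N i and N (s i) are transposes of each other, so the eigenvalues of a common
    eigenvector are conjugate. *)
Lemma fchar_dual j i : fchar j (s i) = (fchar j i)^*.
Proof.
have S0 : \sum_k fchar j k * (fchar j k)^* != 0.
  rewrite gt_eqF // (bigD1 ord0) //=; apply: ltr_pwDl.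
    by rewrite fchar_unit conjC1 mulr1 ltr01.
  by apply: sumr_ge0 => k _; rewrite mul_conjC_ge0.
apply: (mulIf S0); rewrite !mulr_sumr.
transitivity (\sum_k \sum_l (N (s i) k l)%:R * fchar j l * (fchar j k)^*).
  by apply: eq_bigr => k _; rewrite mulrA fchar_mul mulr_suml.
rewrite exchange_big; apply: eq_bigr => l _ /=.
rewrite mulrCA -rmorphM fchar_mul rmorph_sum mulr_sumr; apply: eq_bigr => k _.
by rewrite rmorphM /= conjC_nat Ns mulrCA mulrA.
Qed.

Lemma delta_int i : exists a : nat, delta i = a%:R /\ (0 < a)%N.
Proof.
have [m0 m0E] := d_int ord0; have [m mE] := d_int i.
have deltaQ : delta i = ratr (m%:~R / m0%:~R).
  by rewrite deltaE m0E mE fmorph_div /= !ratr_int.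
have [||z zE] := @int_of_rat_eigenvalue K _ (fun k l => (N i k l)%:Z) delta
  (m%:~R / m0%:~R) ord0.
- by rewrite fchar_unit oner_eq0.
- by move=> k; rewrite -deltaQ fchar_mul; apply: eq_bigr => l _; rewrite pmulrn.
have := delta_gt0 i; rewrite deltaQ zE ratr_int.
case: z {zE} => [a | a]; last by rewrite NegzE ltr0z.
by rewrite ltr0z => a0; exists a.
Qed.

(** The integer matrix is that of the multiplication by the sum of the products
    X_i X_(s i), and the j-th character is an eigenvector. *)
Lemma casimir_int j : exists x : nat, gdim / d j ^+ 2 = x%:R.
Proof.
have [m mE] : exists m : I -> int, forall i, d i = (m i)%:~R.
  by apply: (@fin_all_exists _ _ (fun i m => d i = m%:~R)).
pose q : rat := (\sum_i (m i) ^+ 2)%:~R / (m j ^+ 2)%:~R.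
have qE : gdim / d j ^+ 2 = ratr q.
  rewrite /q fmorph_div /= !ratr_int mE rmorphXn /= rmorph_sum; congr (_ / _).
  by apply: eq_bigr => i _; rewrite mE rmorphXn.
have [||z zE] := @int_of_rat_eigenvalue K _
   (fun k l => (\sum_i \sum_t N i k t * N (s i) t l)%N%:Z) (fchar j) q ord0.
- by rewrite fchar_unit oner_eq0.
- move=> k; rewrite -qE -sum_fchar_dual mulr_suml.
  transitivity (\sum_i \sum_t \sum_l (N i k t)%:R * ((N (s i) t l)%:R * fchar j l)).
    under eq_bigr => l _ do rewrite -pmulrn natr_sum mulr_suml.
    rewrite exchange_big; apply: eq_bigr => i _ /=.
    under eq_bigr => l _ do rewrite natr_sum mulr_suml.
    rewrite exchange_big; apply: eq_bigr => t _ /=.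
    by apply: eq_bigr => l _; rewrite natrM mulrA.
  apply: eq_bigr => i _; rewrite mulrAC fchar_mul mulr_suml; apply: eq_bigr => t _.
  by rewrite -mulr_sumr -fchar_mul mulrA mulrAC.
have : 0 < gdim / d j ^+ 2 by rewrite divr_gt0 ?gdim_gt0 ?exprn_gt0.
rewrite qE zE ratr_int; case: z {zE} => [a | a]; last by rewrite NegzE ltr0z.
by exists a.
Qed.

(** If delta_i = 1, then X_i X_(s i) has dimension 1 and contains the unit, so it
    is the unit and the i-th term is 1.  The other terms are nonnegative. *)
Lemma casimir_ge j :
  (\sum_i (delta i == 1%R))%N%:R <= gdim / d j ^+ 2.
Proof.
rewrite -sum_fchar_dual natr_sum; apply: ler_sum => i _.
case: eqP => [di1 | _]; last by rewrite fchar_dual mul_conjC_ge0.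
rewrite fchar_mul (bigD1 ord0) //= fchar_unit mulr1 Nd eqxx big1 ?addr0 // => l l0.
have : \sum_l (N i (s i) l)%:R * delta l = 1 by rewrite -fchar_mul delta_dual di1 mulr1.
rewrite (bigD1 ord0) //= fchar_unit mulr1 Nd eqxx (bigD1 l) //= -[X in _ = X]addr0.
move=> /addrI /eqP; rewrite paddr_eq0; last first.
- by apply: sumr_ge0 => m _; rewrite mulr_ge0 ?ler0n // ltW ?delta_gt0.
- by rewrite mulr_ge0 ?ler0n // ltW ?delta_gt0.
by rewrite mulf_eq0 (gt_eqF (delta_gt0 l)) orbF => /andP[/eqP-> _]; rewrite mul0r.
Qed.

End Dual.

(** If the dimensions are 1, the coefficients of the product of two simple objects
    add up to 1, so the product is a simple object.  The characters, which
    separate the simple objects, become multiplicative for this operation. *)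
Lemma fusion_op : (forall i, fchar ord0 i = 1) ->
  exists op : I -> I -> I, (forall i k l, N i k l = (l == op i k)) /\
    forall j i k, fchar j (op i k) = fchar j i * fchar j k.
Proof.
move=> d1.
have N1 i k : (\sum_l N i k l = 1)%N.
  apply/eqP; rewrite -(eqr_nat K) natr_sum.
  apply/eqP; transitivity (fchar ord0 i * fchar ord0 k); last by rewrite !d1 mulr1.
  by rewrite fchar_mul; apply: eq_bigr => l _; rewrite d1 mulr1.
have [op opP] : exists op : I * I -> I, forall x, N x.1 x.2 (op x) != 0%N.
  apply: (@fin_all_exists _ _ (fun x l => N x.1 x.2 l != 0%N)) => -[i k] /=.
  case: (pickP (fun l => N i k l != 0%N)) => [l Nl | Nl]; first by exists l.
  by have := N1 i k; rewrite big1 // => l _; apply/eqP/negbFE/Nl.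
have opE i k l : N i k l = (l == op (i, k)).
  have := N1 i k; rewrite (bigD1 (op (i, k))) //=.
  have := opP (i, k); rewrite /=; case E: (N i k _) => [|m] // _.
  rewrite addSn => -[] /eqP; rewrite addn_eq0 => /andP[/eqP m0 /eqP m1].
  case: eqP => [-> | /eqP l0]; first by rewrite E m0.
  by move/eqP: m1; rewrite (bigD1 l) //= addn_eq0 => /andP[/eqP].
exists (fun i k => op (i, k)); split=> // j i k.
rewrite fchar_mul (bigD1 (op (i, k))) //= opE eqxx mul1r big1 ?addr0 // => l l0.
by rewrite opE (negPf l0) mul0r.
Qed.

End FusionData.

Section RankFive.
Variables (K : numClosedFieldType).
Local Notation I := 'I_5.
Variables (N : I -> I -> I -> nat) (M : I -> I -> nat).
Variables (h : I -> I -> K) (d : I -> K).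
Hypothesis NC : forall i k l, N i k l = N k i l.
Hypothesis N0 : forall k l, N ord0 k l = (k == l).
Hypothesis NM : forall i k l, (\sum_m M i m * N m k l)%N = N i l k.
Hypothesis hM : forall i k j, h i j * h k j = d j * \sum_l (N i k l)%:R * h l j.
Hypothesis hS : forall i j, h i j = h j i.
Hypothesis h0 : forall j, h ord0 j = d j.
Hypothesis hU : \matrix_(i, j) h i j \in unitmx.
Hypothesis d_gt0 : forall i, 0 < d i.
Hypothesis d_int : forall i, exists m : int, d i = m%:~R.
Local Notation fchar := (fchar h d).

(** The case of one dimension 2 is excluded by counting: there the quotient
    D / d_j^2 for the object of dimension 2 is 2, and four dimensions are 1. *)
Lemma delta_eq1 i : fchar ord0 i = 1.
Proof.
have [s [sK Ns Nd]] := dual_perm NC N0 NM.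
have [a aP] : exists a : I -> nat, forall i, fchar ord0 i = (a i)%:R /\ (0 < a i)%N.
  by apply: (@fin_all_exists _ _ (fun i a => fchar ord0 i = a%:R /\ (0 < a)%N)) => k;
     apply: delta_int.
have dE k : d k = (a k)%:R * d ord0.
  by have [<- _] := aP k; rewrite (deltaE hS h0) divfK ?(d_neq0 d_gt0).
have d00 : d ord0 ^+ 2 != 0 by rewrite expf_neq0 ?(d_neq0 d_gt0).
have gdimE : gdim d = (\sum_k a k ^ 2)%:R * d ord0 ^+ 2.
  rewrite natr_sum mulr_suml; apply: eq_bigr => k _.
  by rewrite [in LHS]dE exprMn natrX.
have [x xP] : exists x : I -> nat, forall j, gdim d / d j ^+ 2 = (x j)%:R.
  apply: (@fin_all_exists _ _ (fun j x => gdim d / d j ^+ 2 = x%:R)) => j.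
  exact: (casimir_int NC hM hS h0 hU d_gt0 d_int sK Ns Nd).
have xE j : (\sum_k a k ^ 2 = x j * a j ^ 2)%N.
  apply/eqP; rewrite -(eqr_nat K) -(inj_eq (mulIf d00)) -gdimE natrM natrX -mulrA.
  by rewrite -exprMn -dE -xP divfK ?expf_neq0 ?(d_neq0 d_gt0).
have a0 : a ord0 = 1%N.
  by apply/eqP; rewrite -(eqr_nat K); have [<- _] := aP ord0; rewrite (fchar_unit h0).
have [||a1|[S8 [j aj] S4]] := @five_squares a => //.
- by move=> j; exists (x j).
- by have [-> _] := aP i; rewrite a1.
have := casimir_ge NC hM hS h0 hU d_gt0 sK Ns Nd j.
rewrite xP ler_nat (eq_bigr (fun k => (a k == 1%N) : nat)); last first.
  by move=> k _; have [-> _] := aP k; rewrite -[1]/(1%:R) eqr_nat.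
by rewrite S4; have := xE j; rewrite S8 aj; case: (x j) => [|[|[|[|m]]]].
Qed.

(** A nontrivial element g of a group of order 5 has order 5: the product of the
    values of a character over the group is unchanged by translation by g, so
    chi(g)^5 = 1, and 5 is prime. *)
Lemma fusion_cyclic : exists (op : I -> I -> I) (phi : 'Z_5 -> I),
  [/\ bijective phi, phi 0 = ord0, forall a b, phi (a + b) = op (phi a) (phi b)
    & forall i k l, N i k l = (l == op i k)].
Proof.
have [op [opE fchar_op]] := fusion_op hM d_gt0 delta_eq1.
have inj := fchar_inj hU d_gt0.
pose g : I := inord 1.
have g0 : g != ord0 by rewrite -val_eqE /= inordK.
have [s [sK Ns Nd]] := dual_perm NC N0 NM.
have fchar_neq0 j i : fchar j i != 0.
  have : fchar j i * fchar j (s i) = 1.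
    rewrite -fchar_op -(fchar_unit h0 d_gt0 j); congr (fchar j _); apply/esym/eqP.
    by have := Nd i (s i); rewrite eqxx opE; case: eqP.
  by apply: contra_eq_neq => ->; rewrite mul0r eq_sym oner_eq0.
have fchar_g5 j : fchar j g ^+ 5 = 1.
  have inj_g : injective (op g).
    move=> i k E; apply: inj => j'; apply: (mulfI (fchar_neq0 j' g)).
    by rewrite -!fchar_op E.
  have P0 : \prod_k fchar j k != 0 by apply/prodf_neq0.
  apply: (mulIf P0); rewrite mul1r {2}(reindex_inj inj_g) /=.
  rewrite -[X in _ ^+ X](card_ord 5) -prodr_const -big_split /=.
  by apply: eq_bigr => k _; rewrite fchar_op.
pose phi (a : 'Z_5) : I := iter a (op g) ord0.
have fchar_phi j a : fchar j (phi a) = fchar j g ^+ a.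
  rewrite /phi; elim: (nat_of_ord a) => [|m IH] /=; first by rewrite (fchar_unit h0).
  by rewrite fchar_op IH exprS.
(* For 1 < m < 5, one of the exponents 5 and 6 is 1 modulo m or divisible by m. *)
have root1 (x : K) m : x ^+ 5 = 1 -> (0 < m < 5)%N -> x ^+ m = 1 -> x = 1.
  move=> x5; have x6 : x ^+ 6 = x by rewrite exprS x5 mulr1.
  case: m => [|[|[|[|[|//]]]]] //= _ xm.
  - by rewrite -x5 (exprD x 4 1) (exprM x 2 2) xm expr1n mul1r.
  - by rewrite -x6 (exprM x 3 2) xm expr1n.
  by rewrite -x5 (exprD x 4 1) xm mul1r.
have phi_lt (a b : 'Z_5) : (a < b)%N -> phi a <> phi b.
  move=> ab E; move/eqP: g0; apply; apply: inj => j.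
  rewrite (fchar_unit h0 d_gt0); apply: (root1 _ (b - a)%N) => //.
    by rewrite subn_gt0 ab /= (leq_ltn_trans (leq_subr _ _)) // (ltn_ord b).
  apply: (mulfI (expf_neq0 a (fchar_neq0 j g))).
  by rewrite -exprD subnKC ?(ltnW ab) // mulr1 -!fchar_phi E.
have phi_inj : injective phi.
  move=> a b E; apply/val_inj/eqP; case: (ltngtP (val a) (val b)) => // ab.
    by case: (phi_lt _ _ ab).
  by case: (phi_lt _ _ ab).
exists op, phi; split=> //.
- by apply: inj_card_bij; rewrite ?card_ord.
- move=> a b; apply: inj => j; rewrite fchar_op !fchar_phi -exprD /=.
  by rewrite -[RHS](expr_mod _ (fchar_g5 j)).
Qed.

End RankFive.

(** * Integral modular categories of rank 5 *)

(** Elements of the two rings are functions on the bases, so the isomorphism is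
    composition with phi. *)
Lemma based_iso_SU5 (K : fieldType) (C : ribbonCat K) (X : 'I_5 -> C)
    (op : 'I_5 -> 'I_5 -> 'I_5) (phi : 'Z_5 -> 'I_5) :
    bijective phi -> phi 0 = ord0 -> (forall a b, phi (a + b) = op (phi a) (phi b)) ->
    (forall i k l, fusion_coef (X i) (X k) (X l) = (l == op i k)) ->
  based_iso (Gr X) Gr_SU5_1.
Proof.
move=> [psi phiK psiK] phi0 phiD fusE.
have phi_inj := can_inj phiK.
pose f (x : bcarrier (Gr X)) : bcarrier Gr_SU5_1 := [ffun a => x (phi a)].
have f_basis i : f (@bbasis (Gr X) i) = @bbasis Gr_SU5_1 (psi i).
  by apply/ffunP => a; rewrite !ffunE -[a == _](inj_eq phi_inj) psiK.
exists f; split.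
- pose g (y : bcarrier Gr_SU5_1) : bcarrier (Gr X) := [ffun i => y (psi i)].
  by exists g => x; apply/ffunP => i; rewrite !ffunE ?psiK ?phiK.
- by move=> x y; apply/ffunP => a; rewrite !ffunE.
- move=> x y; apply/ffunP => a; rewrite !ffunE /=.
  rewrite (reindex phi) /=; last by exists psi => ? _; rewrite ?phiK ?psiK.
  apply: eq_bigr => b _.
  rewrite (reindex phi) /=; last by exists psi => ? _; rewrite ?phiK ?psiK.
  apply: eq_bigr => c _; rewrite !ffunE fusE -phiD (inj_eq phi_inj) eq_sym //.
- by rewrite f_basis; congr bbasis; rewrite -[RHS]phiK phi0.
split=> [i | a]; first by exists (psi i).
by exists (phi a); rewrite f_basis phiK.
Qed.

Lemma integral_modular_rank5 (K : numClosedFieldType) (C : ribbonCat K) (X : 'I_5 -> C)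
    (hmod : modular X) :
    (forall Y : C, simple Y -> 0 < qdim Y) ->
    (forall Y : C, simple Y -> exists m : int, qdim Y = m%:~R) ->
  pointed C /\ based_iso (Gr X) Gr_SU5_1.
Proof.
move=> hpos hint.
have d_gt0 i : 0 < qdim_rep X i by apply/hpos/(mod_simple hmod).
have d_int i : exists m : int, qdim_rep X i = m%:~R by apply/hint/(mod_simple hmod).
have d_neq0 i : qdim_rep X i != 0 by rewrite gt_eqF.
have NC := fusion_comm X.
have N0 := fusion_unit hmod.
have NM := fusion_adj hmod.
have hM := hopf_mul hmod.
have hS := hopf_sym X.
have h0 j := hopf0 hmod j d_neq0.
have hU := hopf_unit hmod.
have [op [phi [phi_bij phi0 phiD opE]]] :=
  fusion_cyclic NC N0 NM hM hS h0 hU d_gt0 d_int.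
split; last exact: based_iso_SU5 phi_bij phi0 phiD opE.
move=> Y sY; have [i [YXi _]] := mod_reps hmod sY; apply: invertible_iso YXi _.
have [s [_ _ Nd]] := dual_perm NC N0 NM.
apply: (invertible_of_fusion hmod (j := s i)) => k.
rewrite opE; congr (_ == _); apply/esym/eqP.
by have := Nd i (s i); rewrite eqxx opE; case: eqP.
Qed.

Theorem theorem3p1 (R : realType) (C : ribbonCat R[i]) (X : 'I_5 -> C)
  (hmod : modular X)
  (hpos : forall Y : C, simple Y -> 0 < qdim Y)
  (hint : forall Y : C, simple Y -> exists m : int, qdim Y = m%:~R) :
  pointed C /\ based_iso (Gr X) Gr_SU5_1.
Proof. exact: integral_modular_rank5 hmod hpos hint. Qed.
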